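(* $\mathcal{R}_{\mathrm{det}}(W_{1.5})=\mathrm{P}$: a language is recognized by a deterministic WORM-memory multi-head 2-way automaton on the 1.5-way tape $W_{1.5}$ if and only if it is in $\mathrm{P}$.
   Context: A memory model is a directed graph $(M,E)$ with an initial cell $m_0$ and a marking map $g\colon E\to G$ into a finite set $G$ such that for every vertex the outgoing edges are bijectively marked by $G$. The 1.5-way tape $W_{1.5}$ has cells $0,1,2,\dots$, initial cell $0$, marks $G=\{+,-\}$, and from each cell $n$ an edge $n\to n+1$ marked $+$ and an edge $n\to 0$ marked $-$ (a ''return move''). A WORM-memory automaton on memory model $M$ with $h$ heads has a finite state set $Q$, input alphabet $\Sigma$ with endmarkers $\triangleleft,\triangleright$, memory alphabet $\Delta\cup\{\mathsf{void}\}$, a transition function mapping (state, the $h$ input symbols under the heads, current memory symbol) to (new state, a move in $\{-1,0,+1\}$ for each 2-way read-only head on $\triangleleft w\triangleright$, and a mark in $G$ to move along or ''stay''), initial state $q_0$ (heads at the leftmost symbol of $w$, memory at $m_0$), accepting states, writing states $Q_w\subseteq Q$ and a filling function $\varphi\colon Q_w\to\Delta$. Initially all cells are void. In a writing state $q$: if the current cell is void, $\varphi(q)$ is written; if it already contains $\varphi(q)$, nothing happens; if it contains a different symbol, an error occurs. Applying the transition function on a void cell is an error. On error the automaton rejects. The automaton accepts $w$ iff its deterministic run reaches an accepting state. $\mathcal{R}_{\mathrm{det}}(M)$ is the class of languages so recognized (any number of heads). *)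

(* Defs.v *)
From HB Require Import structures.
From mathcomp Require Import all_boot all_order all_algebra.

Set Implicit Arguments.
Unset Strict Implicit.
Unset Printing Implicit Defensive.

Definition language (Sigma : finType) := seq Sigma -> Prop.

Inductive move := MoveLeft | MoveStay | MoveRight.

Definition upd (T : eqType) (X : Type) (f : T -> X) (a : T) (x : X) : T -> X :=
  fun b => if b == a then x else f b.

(* [mm_edge_at m] is the inverse of the marking on the edges leaving m: the    *)
(* last three fields say that these edges are bijectively marked.              *)
Record memory_model := MemoryModel {
  mm_cell : eqType;
  mm_edge : Type;
  mm_src : mm_edge -> mm_cell;
  mm_tgt : mm_edge -> mm_cell;
  mm_init : mm_cell;
  mm_mark : finType;
  mm_marking : mm_edge -> mm_mark;
  mm_edge_at : mm_cell -> mm_mark -> mm_edge;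
  mm_edge_at_src : forall m g, mm_src (mm_edge_at m g) = m;
  mm_edge_at_mark : forall m g, mm_marking (mm_edge_at m g) = g;
  mm_edge_atK : forall e, mm_edge_at (mm_src e) (mm_marking e) = e
}.

Definition mm_next (M : memory_model) (m : mm_cell M) (g : mm_mark M) :
    mm_cell M :=
  mm_tgt (mm_edge_at m g).

(* Mark "+" is true, mark "-" (the return move) is false; the edge leaving n   *)
(* with mark g is the pair (n, g).                                             *)
Definition W15 : memory_model :=
  @MemoryModel nat (nat * bool)%type
    (fun e => e.1) (fun e => if e.2 then e.1.+1 else 0) 0
    bool (fun e => e.2) (fun n g => (n, g))
    (fun _ _ => erefl) (fun _ _ => erefl)
    (fun e => let: (n, g) := e in erefl).

Inductive insym (Sigma : Type) := LeftEnd | Letter of Sigma | RightEnd.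
Arguments LeftEnd {Sigma}.
Arguments RightEnd {Sigma}.

(* [worm_fill] encodes both Q_w, the set of states where it is not None, and   *)
(* the filling function on Q_w. The void symbol is not an argument of          *)
(* [worm_delta], since applying the transition function to it is an error. In  *)
(* the result of [worm_delta], the memory move None means "stay".              *)
Record worm (M : memory_model) (h : nat) (Sigma : finType) := Worm {
  worm_state : finType;
  worm_mem : finType;
  worm_delta : worm_state -> {ffun 'I_h -> insym Sigma} -> worm_mem ->
    worm_state * {ffun 'I_h -> move} * option (mm_mark M);
  worm_start : worm_state;
  worm_acc : {set worm_state};
  worm_fill : worm_state -> option worm_mem
}.

(* Head positions are indices in the word LeftEnd w RightEnd; a memory cell    *)
(* holding None is void.                                                       *)
Record wconf (M : memory_model) (h : nat) (Sigma : finType)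
    (A : worm M h Sigma) := WConf {
  wc_state : worm_state A;
  wc_heads : {ffun 'I_h -> nat};
  wc_cell : mm_cell M;
  wc_mem : mm_cell M -> option (worm_mem A)
}.

Section WormRun.
Variables (M : memory_model) (h : nat) (Sigma : finType) (A : worm M h Sigma).
Variable w : seq Sigma.

Definition insym_at (p : nat) : insym Sigma :=
  nth RightEnd (LeftEnd :: rcons (map (@Letter Sigma) w) RightEnd) p.

(* A head told to move beyond an endmarker stays on it. *)
Definition move_head (d : move) (p : nat) : nat :=
  match d with
  | MoveLeft => p.-1
  | MoveStay => p
  | MoveRight => minn p.+1 (size w).+1
  end.

(* The symbol to which the transition function is applied, in a state with     *)
(* filling f and on a cell containing x; None if an error occurs.              *)
Definition fill_cell (D : eqType) (f x : option D) : option D :=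
  match f, x with
  | None, _ => x
  | Some d, None => Some d
  | Some d, Some d' => if d == d' then Some d else None
  end.

Definition worm_init : wconf A :=
  WConf (worm_start A) [ffun=> 1] (mm_init M) (fun=> None).

Definition worm_step (c : wconf A) : option (wconf A) :=
  let q := wc_state c in
  let m := wc_cell c in
  if fill_cell (worm_fill q) (wc_mem c m) is Some d then
    let: (q', dirs, g) := worm_delta q [ffun i => insym_at (wc_heads c i)] d in
    Some (WConf q' [ffun i => move_head (dirs i) (wc_heads c i)]
                (if g is Some g' then mm_next m g' else m)
                (upd (wc_mem c) m (Some d)))
  else None.

Definition worm_run (t : nat) : option (wconf A) :=
  iter t (obind worm_step) (Some worm_init).

Definition worm_accepts : Prop :=
  exists (t : nat) (c : wconf A),
    worm_run t = Some c /\ wc_state c \in worm_acc A.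

End WormRun.

Definition R_det (M : memory_model) (Sigma : finType) (L : language Sigma) :
    Prop :=
  exists (h : nat) (A : worm M h Sigma), forall w, L w <-> worm_accepts A w.

(* Tape symbols: None is the blank, Some (inl a) the input letter a, and       *)
(* Some (inr x) an additional tape symbol.                                     *)
Definition tm_sym (Sigma X : finType) : finType := option (Sigma + X).

(* Deterministic Turing machines with k + 1 two-way infinite tapes. *)
Record tm (k : nat) (Sigma : finType) := TM {
  tm_state : finType;
  tm_aux : finType;
  tm_delta : tm_state -> {ffun 'I_k.+1 -> tm_sym Sigma tm_aux} ->
    tm_state * {ffun 'I_k.+1 -> tm_sym Sigma tm_aux * move};
  tm_start : tm_state;
  tm_acc : tm_state;
  tm_rej : tm_state;
  tm_acc_neq_rej : tm_acc != tm_rej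
}.

Record tmconf (k : nat) (Sigma : finType) (T : tm k Sigma) := TMConf {
  tc_state : tm_state T;
  tc_heads : 'I_k.+1 -> int;
  tc_tapes : 'I_k.+1 -> int -> tm_sym Sigma (tm_aux T)
}.

Section TMRun.
Variables (k : nat) (Sigma : finType) (T : tm k Sigma) (w : seq Sigma).

Definition shift_head (d : move) (z : int) : int :=
  match d with
  | MoveLeft => (z - 1)%R
  | MoveStay => z
  | MoveRight => (z + 1)%R
  end.

Definition input_tape (X : finType) (z : int) : tm_sym Sigma X :=
  if z is Posz i then nth None (map (fun a => Some (inl a)) w) i else None.

Definition tm_init : tmconf T :=
  TMConf (tm_start T) (fun=> 0%R)
    (fun i => if i == ord0 then input_tape (tm_aux T) else fun=> None).

Definition tm_halted (c : tmconf T) : bool :=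
  (tc_state c == tm_acc T) || (tc_state c == tm_rej T).

Definition tm_step (c : tmconf T) : tmconf T :=
  if tm_halted c then c else
  let: (q', acts) :=
    tm_delta (tc_state c) [ffun i => tc_tapes c i (tc_heads c i)] in
  TMConf q' (fun i => shift_head (acts i).2 (tc_heads c i))
    (fun i => upd (tc_tapes c i) (tc_heads c i) (acts i).1).

Definition tm_run (t : nat) : tmconf T := iter t tm_step tm_init.

End TMRun.

(* A halted configuration does not change any more, so being halted after      *)
(* p(|w|) steps means halting within p(|w|) steps.                             *)
Definition class_P (Sigma : finType) (L : language Sigma) : Prop :=
  exists (k : nat) (T : tm k Sigma) (p : {poly nat}), forall w : seq Sigma,
    let c := tm_run T w (p.[size w])%R in
    tm_halted c /\ (L w <-> tc_state c = tm_acc T).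

(* Main.v *)
Require Import Defs.
From HB Require Import structures.
From mathcomp Require Import all_boot all_order all_algebra.
From mathcomp Require Import zify.

Set Implicit Arguments.
Unset Strict Implicit.
Unset Printing Implicit Defensive.

Import Order.TTheory GRing.Theory Num.Theory.

(** Finitely many heads on an input of length n form counters in base n + 2:
    each digit is a head position together with a direction, and a carry
    reverses a digit instead of resetting it, so that counting up or down moves
    every head by at most one cell.

    From W_1.5 to P: written cells never change, so a run that repeats a pair
    (state and head positions, cell) is periodic.  Beyond the visited cells the
    run depends only on the state, the heads and the current symbol until the
    next return move, which bounds the number of cells, and hence the time of a
    first acceptance, by a polynomial.  A Turing machine with a polynomial clock
    then simulates the automaton directly.

    From P to W_1.5: the automaton writes the history of the Turing machine, the
    cell s + 1 holding the state and the scanned symbols at time s.  To find the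
    symbols scanned at time t it rescans the history from cell 0: one counter
    per tape holds the distance between the head positions at times t and s, and
    the last symbol written while it was 0 is the one to read.  A second counter
    accumulates the position, so that it becomes the distance counter of the next
    scan. *)

(** * Reflected counters *)

Section Counter.
Variable n : nat.
Local Notation b := (n.+2).
Local Notation bz := (Posz n.+2).

(** Reflected (Gray) code in base n + 2, extended to negative integers by floor division. The parity
    of the quotient above digit [j] decides whether the head shows the digit or its complement to n
    + 1. *)
Definition cquot (j : nat) (z : int) : int := iter j (fun y => (y %/ bz)%Z) z.
Arguments cquot : simpl never.
Definition cval (j : nat) (z : int) : nat := `|(cquot j z %% bz)%Z|%N.
Definition cdir (j : nat) (z : int) : bool := ~~ odd `|cquot j.+1 z|%N.
Definition cpos (j : nat) (z : int) : nat :=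
  if cdir j z then cval j z else n.+1 - cval j z.

Lemma divz_modz_unique (z q r : int) :
  z = (q * bz + r)%R -> (0 <= r < bz)%R ->
  (z %/ bz)%Z = q /\ (z %% bz)%Z = r.
Proof.
move=> -> /andP[r0 rb]; rewrite divzMDl // modzMDl divz_small ?modz_small ?r0 //.
by rewrite addr0.
Qed.

Lemma cval_bound j z : cval j z < b.
Proof. by rewrite /cval; have := @ltz_pmod (cquot j z) bz isT;
  have := @modz_ge0 (cquot j z) bz isT; lia. Qed.

Lemma cquotS j z : cquot j z = (cquot j.+1 z * bz + Posz (cval j z))%R.
Proof.
rewrite /cval /cquot /= gez0_abs ?modz_ge0 //; exact: divz_eq.
Qed.

Lemma cquot_unique j z (q : int) (r : nat) :
  cquot j z = (q * bz + Posz r)%R -> r < b -> cquot j.+1 z = q /\ cval j z = r.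
Proof.
move=> e rb; have [] := divz_modz_unique e; first by lia.
by rewrite /cval /cquot /= => -> ->.
Qed.

Definition cmax (j : nat) (z : int) := cval j z == n.+1.

Lemma cquot_succ j z :
  cquot j (z + 1) = (cquot j z + [forall i : 'I_j, cmax i z])%R.
Proof.
elim: j => [|j IH]; first by rewrite (_ : [forall i, _] = true) //; apply/forallP=> -[].
have -> : [forall i : 'I_j.+1, cmax i z] = [forall i : 'I_j, cmax i z] && cmax j z.
  apply/forallP/andP => [H|[/forallP H1 H2] i].
    split; last by have := H ord_max.
    by apply/forallP=> i; have := H (widen_ord (leqnSn j) i).
  have := ltn_ord i; rewrite ltnS leq_eqVlt => /orP[/eqP->//|lij].
  by have := H1 (Ordinal lij).
have b1 := cval_bound j z; have E := cquotS j z; rewrite E in IH.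
case: [forall i, _] in IH *; rewrite /= ?addr0 in IH *; last first.
  by have [] := cquot_unique IH b1.
rewrite /cmax; case: eqP => h /=.
  have [|//|-> _] := @cquot_unique j (z + 1)%R (cquot j.+1 z + 1)%R 0; last by [].
  by rewrite IH h; lia.
have [||-> _] := @cquot_unique j (z + 1)%R (cquot j.+1 z) (cval j z).+1;
  rewrite ?IH; lia.
Qed.

(** If y = q b + r then - 1 - y = (- 1 - q) b + (b - 1 - r): the reflection commutes with floor
    division and complements every digit. *)
Lemma cquot_refl j z : cquot j (- 1 - z) = (- 1 - cquot j z)%R.
Proof.
elim: j => // j IH; have b1 := cval_bound j z.
have [||-> _] := @cquot_unique j (- 1 - z)%R (- 1 - cquot j.+1 z)%R (n.+1 - cval j z);
  rewrite ?IH ?(cquotS j z); lia.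
Qed.

Lemma cval_refl j z : cval j (- 1 - z) = n.+1 - cval j z.
Proof.
have b1 := cval_bound j z.
have [||_ ->] := @cquot_unique j (- 1 - z)%R (- 1 - cquot j.+1 z)%R (n.+1 - cval j z);
  rewrite ?cquot_refl ?(cquotS j z); lia.
Qed.

Lemma cdir_refl j z : cdir j (- 1 - z) = ~~ cdir j z.
Proof.
rewrite /cdir cquot_refl; case: (cquot _ _) => m.
  by rewrite (_ : `|_|%N = m.+1) /= ?negbK //; lia.
have -> : (- 1 - Negz m = Posz m)%R by lia.
by rewrite /= negbK.
Qed.

Lemma cpos_refl j z : cpos j (- 1 - z) = cpos j z.
Proof.
have b1 := cval_bound j z.
by rewrite /cpos cdir_refl cval_refl; case: cdir => /=; lia.
Qed.

Lemma cpos_bound j z : cpos j z < b.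
Proof. by have b1 := cval_bound j z; rewrite /cpos; case: cdir => /=; lia. Qed.

Lemma cmaxE j z : cmax j z = (cpos j z == if cdir j z then n.+1 else 0).
Proof.
by have b1 := cval_bound j z; rewrite /cmax /cpos; case: cdir => /=; lia.
Qed.

Lemma cval_dvd m z : (forall j, j < m -> cval j z = 0) ->
  z = (cquot m z * Posz (b ^ m))%R.
Proof.
elim: m => [|m IH] H; first by rewrite /cquot /= mulr1.
rewrite {1}IH; last by move=> j jm; apply: H; exact: ltnW.
by rewrite (cquotS m z) H // expnS PoszM addr0 mulrA.
Qed.

Lemma cval_mul_exp m j q : j < m -> cval j (q * Posz (b ^ m)) = 0.
Proof.
have cq k i : cquot i (q * Posz (b ^ (i + k))) = (q * Posz (b ^ k))%R.
  elim: i k => // i IH k; rewrite addSnnS.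
  suff [] : cquot i.+1 (q * Posz (b ^ (i + k.+1))) = (q * Posz (b ^ k))%R /\
            cval i (q * Posz (b ^ (i + k.+1))) = 0 by [].
  by apply: cquot_unique; rewrite // addr0 IH expnS PoszM mulrA mulrAC.
move=> jm; have -> : m = j + (m - j.+1).+1 by lia.
by rewrite /cval cq expnS PoszM mulrCA modzMr.
Qed.

Lemma cquot0 m : cquot m 0 = 0%R.
Proof. by rewrite /cquot; elim: m => //= m ->; rewrite div0z. Qed.

Lemma cquot_small m z : (0 <= z < bz)%R -> 0 < m -> cquot m z = 0%R.
Proof.
case: m => // m hz _; rewrite /cquot iterSr divz_small //; exact: cquot0.
Qed.

Definition cmove (d : move) (p : nat) : nat :=
  match d with MoveLeft => p.-1 | MoveStay => p | MoveRight => minn p.+1 n.+1 end.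

(** * Counting with finitely many heads *)

Variable C : nat.

(** Adding 2 (n + 2)^C to [z] changes none of these digits and directions, so a test on [z] itself
    needs a bound; without one only divisibility can be read off. *)
Definition represents (z : int) (d : 'I_C -> bool) (p : 'I_C -> nat) :=
  forall j : 'I_C, d j = cdir j z /\ p j = cpos j z.

(* A digit at its end in its current direction is exhausted: counting flips    *)
(* its direction instead of moving it, which is what carrying means here.      *)
Definition exhausted (up : bool) (d atl atr : 'I_C -> bool) (j : 'I_C) :=
  if d j == up then atr j else atl j.

Definition carried (e : 'I_C -> bool) (j : 'I_C) :=
  [forall i : 'I_C, (i < j) ==> e i].

Definition count_dir (op : move) (d atl atr : 'I_C -> bool) (j : 'I_C) : bool :=
  let flip up := let e := exhausted up d atl atr in carried e j && e j in
  match op with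
  | MoveStay => d j
  | MoveLeft => d j (+) flip false
  | MoveRight => d j (+) flip true
  end.

Definition count_move (op : move) (d atl atr : 'I_C -> bool) (j : 'I_C) : move :=
  let go up := let e := exhausted up d atl atr in
    if carried e j && ~~ e j then if d j == up then MoveRight else MoveLeft
    else MoveStay in
  match op with
  | MoveStay => MoveStay
  | MoveLeft => go false
  | MoveRight => go true
  end.

Definition is_zero (d atl atr : 'I_C -> bool) (j : 'I_C) :=
  if d j then atl j else atr j.

Definition at_left (p : 'I_C -> nat) j := p j == 0.
Definition at_right (p : 'I_C -> nat) j := p j == n.+1.

Lemma carried_cmax z (j : 'I_C) :
  [forall i : 'I_j, cmax i z] = carried (fun i => cmax i z) j.
Proof.
apply/forallP/forallP => H i.
  by apply/implyP=> ij; have := H (Ordinal ij).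
have lt : i < C by apply: ltn_trans (ltn_ord j).
by have := H (Ordinal lt); rewrite /= ltn_ord.
Qed.

Lemma eq_carried (e e' : 'I_C -> bool) : e =1 e' -> carried e =1 carried e'.
Proof. by move=> ee j; apply: eq_forallb => i; rewrite ee. Qed.

Lemma eq_exhausted up d atl atr atl' atr' : atl =1 atl' -> atr =1 atr' ->
  exhausted up d atl atr =1 exhausted up d atl' atr'.
Proof. by move=> el er j; rewrite /exhausted el er. Qed.

Lemma eq_count_dir op d atl atr atl' atr' : atl =1 atl' -> atr =1 atr' ->
  count_dir op d atl atr =1 count_dir op d atl' atr'.
Proof.
move=> el er j; have E up := eq_exhausted up d el er.
by rewrite /count_dir !(eq_carried (E _)) !E.
Qed.

Lemma eq_count_move op d atl atr atl' atr' : atl =1 atl' -> atr =1 atr' ->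
  count_move op d atl atr =1 count_move op d atl' atr'.
Proof.
move=> el er j; have E up := eq_exhausted up d el er.
by rewrite /count_move !(eq_carried (E _)) !E.
Qed.

Lemma represents_incr z d p : represents z d p ->
  represents (z + 1) (count_dir MoveRight d (at_left p) (at_right p))
    (fun j => cmove (count_move MoveRight d (at_left p) (at_right p) j) (p j)).
Proof.
move=> R j; rewrite /count_dir /count_move.
have E : exhausted true d (at_left p) (at_right p) =1 (fun i => cmax i z).
  move=> i; have [di pi] := R i; rewrite cmaxE /exhausted /at_left /at_right.
  by rewrite di pi eqb_id; case: cdir.
rewrite (eq_carried E) E -carried_cmax.
have [-> ->] := R j; rewrite eqb_id.
have b1 := cval_bound j z; have Eq := cquotS j z.
have S := cquot_succ j z; rewrite {}Eq in S.
case: [forall i, _] S => /= S; last first.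
  have [|//|e1 e2] := @cquot_unique j (z + 1)%R (cquot j.+1 z) (cval j z).
    by rewrite S addr0.
  by rewrite addbF /cpos /cdir e1 e2.
(* Roll-over: the value drops from n + 1 to 0 while the parity of the next quotient flips, so the
   position is unchanged. *)
rewrite /cmax; case: eqP => h.
  have [|//|e1 e2] := @cquot_unique j (z + 1)%R (cquot j.+1 z + 1)%R 0.
    by rewrite S h; lia.
  have e3 : cdir j (z + 1) = ~~ cdir j z.
    rewrite /cdir e1; case: (cquot _ _) => [m|[|m]] //.
      by rewrite (_ : (Posz m + 1)%R = Posz m.+1) ?oddS //; lia.
    by rewrite (_ : (Negz m.+1 + 1)%R = Negz m) /= ?negbK //; lia.
  by rewrite addbT /cpos e3 e2 h; case: cdir => /=; lia.
have [||e1 e2] := @cquot_unique j (z + 1)%R (cquot j.+1 z) (cval j z).+1;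
  rewrite ?S; try lia.
rewrite addbF /cpos /cdir e1 e2 -/(cdir j z); case: (cdir j z) => /=; lia.
Qed.

(* Hence counting down is counting up with all directions reversed.            *)
Lemma represents_refl z d p : represents z d p <->
  represents (- 1 - z) (fun j => ~~ d j) p.
Proof.
split=> R j; have := R j; rewrite cdir_refl cpos_refl => -[dj ->].
  by rewrite dj.
by rewrite -(negbK (d j)) dj negbK.
Qed.

Lemma represents_count op z d p : represents z d p ->
  represents (shift_head op z) (count_dir op d (at_left p) (at_right p))
    (fun j => cmove (count_move op d (at_left p) (at_right p) j) (p j)).
Proof.
case: op => R //; last exact: represents_incr.
apply/represents_refl; have := represents_incr (proj1 (represents_refl _ _ _) R).
rewrite /= (_ : (- 1 - z + 1 = - 1 - (z - 1))%R); last by lia.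
move=> R' j; have := R' j; rewrite /count_dir /count_move.
have E : exhausted true (fun i => ~~ d i) (at_left p) (at_right p) =1
         exhausted false d (at_left p) (at_right p).
  by move=> i; rewrite /exhausted; case: (d i).
by rewrite (eq_carried E) E addNb; case: (d j).
Qed.

Lemma is_zeroE z d p j : represents z d p ->
  is_zero d (at_left p) (at_right p) j = (cval j z == 0).
Proof.
move=> R; have [dj pj] := R j; have b1 := cval_bound j z.
by rewrite /is_zero /at_left /at_right dj pj /cpos; case: cdir => /=; lia.
Qed.

Lemma all_is_zero_dvd z d p : represents z d p ->
  [forall j, is_zero d (at_left p) (at_right p) j] = (Posz (b ^ C) %| z)%Z.
Proof.
move=> R; apply/forallP/dvdzP => [H|[q zq] j].
  exists (cquot C z); apply: cval_dvd => j jC.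
  by apply/eqP; rewrite -(is_zeroE (Ordinal jC) R).
by rewrite (is_zeroE j R) zq cval_mul_exp.
Qed.

Lemma dvdz_small (m : nat) (z : int) :
  `|z|%N < m -> (Posz m %| z)%Z -> z = 0%R.
Proof.
move=> zm /dvdzP[q e]; move: zm; rewrite e abszM /=.
case: (q =P 0%R) => [->|q0]; first by rewrite mul0r.
have : 0 < `|q|%N by rewrite absz_gt0; apply/eqP.
by case: (`|q|%N) => // k _; rewrite mulSn; lia.
Qed.

Lemma all_is_zeroE z d p : represents z d p -> `|z|%N < b ^ C ->
  [forall j, is_zero d (at_left p) (at_right p) j] = (z == 0%R).
Proof.
move=> R zC; rewrite (all_is_zero_dvd R); apply/idP/eqP => [|->]; last exact: dvdz0.
exact: dvdz_small.
Qed.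

Lemma all_exhaustedE z d p : represents z d p -> (0 <= z < Posz (b ^ C))%R ->
  [forall j, exhausted true d (at_left p) (at_right p) j] = (z + 1 == Posz (b ^ C))%R.
Proof.
move=> R zC.
(* A digit exhausted upwards is a zero digit of the reflection - 1 - z, so the test says that (n +
   2)^C divides z + 1. *)
have -> : [forall j, exhausted true d (at_left p) (at_right p) j] =
          [forall j, is_zero (fun j => ~~ d j) (at_left p) (at_right p) j].
  by apply: eq_forallb => j; rewrite /exhausted /is_zero; case: (d j).
rewrite (all_is_zero_dvd (proj1 (represents_refl _ _ _) R)).
have -> : (- 1 - z = - (z + 1))%R by lia.
rewrite rpredN; apply/idP/eqP => [h|->]; last exact: dvdzz.
have : (Posz (b ^ C) %| (z + 1 - Posz (b ^ C))%R)%Z by rewrite rpredB ?dvdzz.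
by move/dvdz_small; lia.
Qed.

(** This detects the values shown by the head of digit 0 alone. If the higher digits vanish, [z]
    minus its lowest digit is a multiple of (n + 2)^C, and the margin n + 2 in the bound forces it
    to be 0. *)
Lemma high_is_zeroE z d p : represents z d p -> `|z|%N + b <= b ^ C ->
  [forall j : 'I_C, (0 < j) ==> is_zero d (at_left p) (at_right p) j] =
  (0 <= z < bz)%R.
Proof.
move=> R zC; apply/forallP/idP => [H|zb j].
  have b1 := cval_bound 0 z; pose z' := (z - Posz (cval 0 z))%R.
  have [q1 v0] : cquot 1 z' = cquot 1 z /\ cval 0 z' = 0.
    have e : z = (cquot 1 z * bz + Posz (cval 0 z))%R := cquotS 0 z.
    apply: cquot_unique => //; change (z' = (cquot 1 z * bz + 0)%R).
    by apply/eqP; rewrite addr0 subr_eq -e.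
  have qS j : cquot j.+1 z' = cquot j.+1 z.
    by elim: j => // j IH; rewrite /cquot iterS -/(cquot _ _) IH.
  have : z' = 0%R.
    apply: (@dvdz_small (b ^ C)); first by rewrite /z'; lia.
    apply/dvdzP; exists (cquot C z'); apply: cval_dvd => -[|j] jC //.
    have := H (Ordinal jC); rewrite (is_zeroE _ R) /= => /eqP <-.
    by rewrite /cval qS.
  by rewrite /z'; lia.
by apply/implyP=> j0; rewrite (is_zeroE j R) /cval cquot_small ?mod0z.
Qed.

Lemma represents_digit0 z d p (j : 'I_C) : represents z d p ->
  (0 <= z < bz)%R -> j = 0 :> nat -> Posz (p j) = z.
Proof.
move=> R zb j0; have [_ ->] := R j; rewrite j0 /cpos /cdir cquot_small //=.
by rewrite /cval /cquot /= modz_small //; lia.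
Qed.

Lemma represents_small (z : nat) : z < b ->
  represents (Posz z) (fun=> true) (fun j => if j == 0 :> nat then z else 0).
Proof.
move=> zb j; rewrite /cpos /cdir cquot_small; last 2 first.
- by rewrite lez_nat ltz_nat.
- by [].
split=> //=; case: eqP => [->|/eqP j0].
  by rewrite /cval /cquot /= modz_small.
by rewrite /cval cquot_small ?mod0z ?lt0n ?j0 ?lez_nat.
Qed.
End Counter.

(** * Functions bounded by a power of n + 2 *)

Section PolynomiallyBounded.

(** The bound is the number of values of a counter with [c] digits; as the base is at least 2, the
    exponent absorbs constants. *)
Definition poly_bounded (f : nat -> nat) := exists c, forall n, f n <= n.+2 ^ c.

Lemma poly_bounded_const a : poly_bounded (fun=> a).
Proof.
exists a => n; apply: leq_trans (ltnW (ltn_expl a (ltnSn 1))) _.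
by case: a => // a; rewrite leq_exp2r.
Qed.

Lemma poly_bounded_mul f g : poly_bounded f -> poly_bounded g ->
  poly_bounded (fun n => f n * g n).
Proof. by move=> [c fc] [c' gc]; exists (c + c') => n; rewrite expnD leq_mul. Qed.

Lemma poly_bounded_add f g : poly_bounded f -> poly_bounded g ->
  poly_bounded (fun n => f n + g n).
Proof.
move=> [c fc] [c' gc]; exists (c + c').+1 => n; rewrite expnS expnD.
have := fc n; have := gc n.
have : 0 < n.+2 ^ c by rewrite expn_gt0.
have : 0 < n.+2 ^ c' by rewrite expn_gt0.
move: (n.+2 ^ c) (n.+2 ^ c') => x y; nia.
Qed.

Lemma poly_bounded_id : poly_bounded (fun n => n.+2).
Proof. by exists 1 => n; rewrite expn1. Qed.

Lemma poly_bounded_exp f k : poly_bounded f -> poly_bounded (fun n => f n ^ k).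
Proof.
move=> [c fc]; exists (c * k) => n.
by rewrite expnM; case: k => // k; rewrite leq_exp2r.
Qed.

Lemma poly_bounded_horner (p : {poly nat}) : poly_bounded (fun n => p.[n]%R).
Proof.
elim/poly_ind: p => [|p a [c pc]].
  by exists 0 => n; rewrite horner0.
have [c' H] : poly_bounded (fun n => n.+2 ^ c * n.+2 + a).
  apply: poly_bounded_add (poly_bounded_const a).
  by apply: poly_bounded_mul poly_bounded_id; exists c.
exists c' => n; apply: leq_trans (H n); rewrite hornerMXaddC.
by apply: (@leq_add (_ * _) a); rewrite // leq_mul // leqW.
Qed.
End PolynomiallyBounded.

(** * Time of a first acceptance on W_1.5 *)

Lemma fill_cell_id (D : eqType) (f : option D) x d :
  fill_cell f (Some x) = Some d -> d = x.
Proof. by case: f => [y|] /=; [case: eqP => // <- [] | case]. Qed.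

Lemma fill_cell_idem (D : eqType) (f : option D) x d :
  fill_cell f x = Some d -> fill_cell f (Some d) = Some d.
Proof.
case: f x => [y|] [x|] //=; first by case: eqP => // _ [->]; rewrite eqxx.
by case=> ->; rewrite eqxx.
Qed.

Section TapeW15.
Variables (h : nat) (Sigma : finType) (A : worm W15 h Sigma) (w : seq Sigma).
Implicit Types c : wconf A.

Definition cell c : nat := wc_cell c.

Definition next_cell (m : nat) (g : option bool) : nat :=
  if g is Some g' then if g' then m.+1 else 0 else m.

Definition worm_action c d :=
  worm_delta (wc_state c) [ffun i => insym_at w (wc_heads c i)] d.

Lemma worm_stepP c c' : worm_step w c = Some c' ->
  exists2 d, fill_cell (worm_fill (wc_state c)) (wc_mem c (cell c)) = Some d
  & [/\ wc_state c' = (worm_action c d).1.1,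
        wc_heads c' = [ffun i => move_head w ((worm_action c d).1.2 i) (wc_heads c i)],
        cell c' = next_cell (cell c) (worm_action c d).2
      & wc_mem c' = upd (wc_mem c) (cell c) (Some d)].
Proof.
rewrite /worm_step /worm_action; case F: fill_cell => [d|] //.
case E: worm_delta => [[q' dirs] g] [<-]; exists d => //.
by rewrite E; split=> //=; case: g {E} => [[]|].
Qed.

Lemma worm_step_fill c d :
  fill_cell (worm_fill (wc_state c)) (wc_mem c (cell c)) = Some d ->
  exists c', [/\ worm_step w c = Some c', wc_state c' = (worm_action c d).1.1,
    wc_heads c' = [ffun i => move_head w ((worm_action c d).1.2 i) (wc_heads c i)],
    cell c' = next_cell (cell c) (worm_action c d).2
  & wc_mem c' = upd (wc_mem c) (cell c) (Some d)].
Proof.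
move=> F; case E: (worm_step w c) => [c'|]; last first.
  by move: E; rewrite /worm_step -/(cell c) F; case: worm_delta => [[]].
by have [d'] := worm_stepP E; rewrite F => -[<-] []; exists c'.
Qed.

Lemma worm_runS t : worm_run A w t.+1 = obind (worm_step w (A := A)) (worm_run A w t).
Proof. by []. Qed.

Lemma move_head_le dir p : p <= (size w).+1 -> move_head w dir p <= (size w).+1.
Proof. case: dir => //=; lia. Qed.

Lemma worm_run_heads t c : worm_run A w t = Some c ->
  forall i, wc_heads c i <= (size w).+1.
Proof.
elim: t c => [c [<-] i|t IH c]; first by rewrite ffunE.
rewrite worm_runS; case E: (worm_run A w t) => [c0|] //= /worm_stepP[d _ [_ -> _ _]] i.
by rewrite ffunE move_head_le // IH.
Qed.

Lemma worm_run_prefix t t' c : worm_run A w t = Some c -> t' <= t ->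
  exists c', worm_run A w t' = Some c'.
Proof.
elim: t c => [c e|t IH c e]; first by rewrite leqn0 => /eqP->; exists c.
rewrite leq_eqVlt => /orP[/eqP->|]; first by exists c.
rewrite ltnS; move: e; rewrite worm_runS; case E: (worm_run A w t) => [c0|] //= _.
exact: IH E.
Qed.

Section FirstAcceptance.
Variables (T : nat) (C : nat -> wconf A).
Hypothesis runC : forall t, t <= T -> worm_run A w t = Some (C t).
Hypothesis acc_T : wc_state (C T) \in worm_acc A.
Hypothesis nacc : forall t, t < T -> wc_state (C t) \notin worm_acc A.

Lemma stepC t : t < T -> worm_step w (C t) = Some (C t.+1).
Proof.
by move=> tT; have := runC tT; rewrite worm_runS (runC (ltnW tT)).
Qed.

Lemma C0 : C 0 = worm_init A.
Proof. by have := runC (leq0n T) => -[]. Qed.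

Lemma mem_mono t t' m d : t <= t' -> t' <= T ->
  wc_mem (C t) m = Some d -> wc_mem (C t') m = Some d.
Proof.
move=> tt'; rewrite -(subnKC tt'); elim: (t' - t) => [|i IH]; first by rewrite addn0.
rewrite addnS => lt e; have {}e := IH (ltnW lt) e.
have [d' fd [_ _ _ ->]] := worm_stepP (stepC lt).
rewrite /upd; case: eqP => // em; rewrite -em in fd; rewrite e in fd.
by rewrite (fill_cell_id fd).
Qed.

Lemma mem_filled t m : t <= T -> wc_mem (C t) m != None ->
  exists2 u, u < t & cell (C u) = m.
Proof.
elim: t => [|t IH] tT; first by rewrite C0.
have [d' fd [_ _ _ ->]] := worm_stepP (stepC tT).
rewrite /upd; case: (m =P _) => [-> _|_ /(IH (ltnW tT)) [u ut e]]; first by exists t.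
by exists u => //; apply: ltnW.
Qed.

Definition same_surface c c' :=
  wc_state c = wc_state c' /\ wc_heads c = wc_heads c'.

Lemma same_surface_action c c' d : same_surface c c' ->
  worm_action c d = worm_action c' d.
Proof. by case=> e1 e2; rewrite /worm_action e1 e2. Qed.

(* The cell visited at time u + i still holds at time u' + i what was read     *)
(* there, so the run from u' copies the run from u step by step.               *)
Lemma repeat_key u u' i : u < u' -> u' + i <= T ->
  same_surface (C u) (C u') -> cell (C u) = cell (C u') ->
  same_surface (C (u + i)) (C (u' + i)) /\ cell (C (u + i)) = cell (C (u' + i)).
Proof.
move=> uu'; elim: i => [|i IH]; first by rewrite !addn0.
rewrite !addnS => lt sS sc; have {sS sc} [sS sc] := IH (ltnW lt) sS sc.
have lt1 : u + i < T by lia.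
have [d fd [es eh ec em]] := worm_stepP (stepC lt1).
have [d' fd' [es' eh' ec' _]] := worm_stepP (stepC lt).
have md : wc_mem (C (u' + i)) (cell (C (u' + i))) = Some d.
  apply: (@mem_mono (u + i).+1); [lia | lia |].
  by rewrite em /upd sc eqxx.
move: fd'; rewrite md -(proj1 sS) (fill_cell_idem fd) => -[?]; subst d'.
rewrite /same_surface es es' eh eh' ec ec' -(same_surface_action d sS) -sc.
by rewrite (proj2 sS).
Qed.

(** Otherwise the accepting state of time [T] would already occur at time u + (T - u'), before the
    first acceptance. *)
Lemma key_inj u u' : u < u' -> u' <= T ->
  same_surface (C u) (C u') -> cell (C u) = cell (C u') -> False.
Proof.
move=> uu' u'T s e.
have := @repeat_key u u' (T - u') uu'; rewrite subnKC // => /(_ (leqnn T) s e) [[es _] _].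
by have /negP := @nacc (u + (T - u')) ltac:(lia); rewrite es.
Qed.

(** The inequality is not strict: the current cell may already be filled, and only the cells beyond
    it are surely void. Hence the content of the current cell enters the keys below. *)
Definition virgin t := [forall u : 'I_t.+1, cell (C u) <= cell (C t)].

Lemma virgin_void t x : t <= T -> virgin t -> cell (C t) < x -> wc_mem (C t) x = None.
Proof.
move=> tT /forallP V lt; apply/eqP/negPn/negP => /(mem_filled tT) [u ut e].
have := V (Ordinal (ltnW ut : u < t.+1)); rewrite /= e; lia.
Qed.

(** The start of the current sweep. The value 0 in the base case is correct because the run starts
    in cell 0. *)
Fixpoint last_zero t :=
  if t is t'.+1 then if cell (C t) == 0 then t else last_zero t' else 0.

Lemma last_zero_le t : last_zero t <= t.
Proof. by elim: t => //= t IH; case: ifP => // _; apply: leqW. Qed.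

Lemma last_zero_cell t : cell (C (last_zero t)) = 0.
Proof.
elim: t => [|t IH]; first by rewrite /= C0.
by rewrite [last_zero _]/=; case: eqP.
Qed.

Lemma last_zero_mono t t' : t <= t' -> last_zero t <= last_zero t'.
Proof.
move=> /subnKC <-; elim: (t' - t) => [|i IH]; first by rewrite addn0.
rewrite addnS /=; case: ifP => // _; have := last_zero_le t; lia.
Qed.

Lemma same_last_zero u u' v : last_zero u = last_zero u' ->
  u < v <= u' -> cell (C v) != 0.
Proof.
move=> e /andP[uv vu]; apply/negP => v0.
have lv : last_zero v = v by case: v uv vu v0 => //= v _ _ ->.
by have := last_zero_mono vu; have := last_zero_le u; lia.
Qed.

Lemma step_virgin c c' : worm_step w c = Some c' -> cell c' != 0 ->
  (forall x, cell c < x -> wc_mem c x = None) ->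
  (forall x, cell c' < x -> wc_mem c' x = None) /\ cell c <= cell c'.
Proof.
move=> /worm_stepP [d _ [_ _ -> ->]]; rewrite /next_cell.
case: (_.2) => [[]|] //= _ H; split=> // x lt; rewrite /upd;
  (case: eqP => [e|_]; [by move: lt; rewrite e; lia | apply: H; lia]).
Qed.

(* Beyond the cells visited so far the run depends only on the surface and on  *)
(* the content of the current cell, up to a shift of the tape, until the next  *)
(* return move.                                                                *)
Lemma repeat_virgin u u' i : u < u' -> u' + i <= T ->
  virgin u -> virgin u' -> last_zero u = last_zero u' ->
  same_surface (C u) (C u') ->
  wc_mem (C u) (cell (C u)) = wc_mem (C u') (cell (C u')) ->
  [/\ same_surface (C (u + i)) (C (u' + i)),
    wc_mem (C (u + i)) (cell (C (u + i))) = wc_mem (C (u' + i)) (cell (C (u' + i))),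
    forall x, cell (C (u + i)) < x -> wc_mem (C (u + i)) x = None,
    forall x, cell (C (u' + i)) < x -> wc_mem (C (u' + i)) x = None
    & forall v, u < v <= u' + i -> cell (C v) != 0].
Proof.
move=> uu' + Vu Vu' lz; elim: i => [|i IH].
  rewrite !addn0 => u'T sS sm; split=> // x; try by apply: virgin_void => //; lia.
  exact: same_last_zero.
rewrite !addnS => lt sS sm; have {sS sm} [sS sm V V' nz] := IH (ltnW lt) sS sm.
have lt1 : u + i < T by lia.
(* As u < u', time u + i + 1 lies in the range where cell 0 is already excluded. *)
have nz1 : cell (C (u + i).+1) != 0 by apply: nz; lia.
have [W _] := step_virgin (stepC lt1) nz1 V.
have [d fd [es eh ec em]] := worm_stepP (stepC lt1).
have [d' fd' [es' eh' ec' em']] := worm_stepP (stepC lt).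
move: fd'; rewrite -sm -(proj1 sS) fd => -[?]; subst d'.
have ea := same_surface_action d sS.
(* Both runs take the same action, which is not a return move, and the later run is not in cell 0,
   so it does not get there. *)
have nz2 : cell (C (u' + i).+1) != 0.
  move: nz1; rewrite ec ec' -ea /next_cell.
  have : cell (C (u' + i)) != 0 by apply: nz; lia.
  by case: (_.2) => [[]|].
have [W' _] := step_virgin (stepC lt) nz2 V'.
split=> //; last first.
- move=> v /andP[uv]; rewrite leq_eqVlt => /orP[/eqP->//|vu]; apply: nz; lia.
- rewrite em em' ec ec' -ea /upd; move: nz1; rewrite ec /next_cell.
  case: (_.2) => [[]|] //=; last by rewrite !eqxx.
  by rewrite !(gtn_eqF (ltnSn _)) V // V'.
by split; rewrite ?es ?es' ?eh ?eh' -ea // (proj2 sS).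
Qed.

(** Two distinct visits to cell 0 with the same surface would contradict [key_inj], so both times
    belong to the same sweep; then [repeat_virgin] copies the acceptance to an earlier time. *)
Lemma virgin_inj u u' : u < u' -> u' <= T -> virgin u -> virgin u' ->
  same_surface (C (last_zero u)) (C (last_zero u')) ->
  same_surface (C u) (C u') ->
  wc_mem (C u) (cell (C u)) = wc_mem (C u') (cell (C u')) -> False.
Proof.
move=> uu' u'T Vu Vu' sz sS sm.
have lz : last_zero u = last_zero u'.
  have := last_zero_mono (ltnW uu'); rewrite leq_eqVlt => /orP[/eqP//|lt].
  have := last_zero_le u'.
  move=> le; case: (key_inj lt _ sz); rewrite ?last_zero_cell //; lia.
have := @repeat_virgin u u' (T - u') uu'.
rewrite subnKC // => /(_ (leqnn T) Vu Vu' lz sS sm) [[es _] _ _ _ _].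
by have /negP := @nacc (u + (T - u')) ltac:(lia); rewrite es.
Qed.

Local Notation n := (size w).
Definition surface_type : finType := (worm_state A * {ffun 'I_h -> 'I_n.+2})%type.
Definition surface c : surface_type := (wc_state c, [ffun i => inord (wc_heads c i)]).

Lemma surfaceP u u' : u <= T -> u' <= T ->
  surface (C u) = surface (C u') -> same_surface (C u) (C u').
Proof.
move=> uT u'T [es /ffunP eh]; split=> //; apply/ffunP => i.
have := eh i; rewrite !ffunE => /(congr1 (@nat_of_ord _)); rewrite !inordK //.
- exact: (worm_run_heads (runC u'T)).
- exact: (worm_run_heads (runC uT)).
Qed.

(** The cell index grows by at most one per step, and each new maximum is reached at a virgin
    time. *)
Lemma cell_lt_virgin t u : t <= T -> u <= t ->
  cell (C u) < \sum_(v < t.+1) virgin v.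
Proof.
elim: t u => [|t IH] u tT ut.
  have -> : u = 0 by lia.
  rewrite big_ord1 C0 /= /cell /= (_ : virgin 0) //.
  by apply/forallP => -[[|//] ?] /=.
rewrite big_ord_recr /=; move: ut; rewrite leq_eqVlt ltnS => /orP[/eqP->|ut]; last first.
  by apply: ltn_addr; apply: IH => //; exact: ltnW.
case V: (virgin t.+1); last first.
  move/negbT: V => /forallPn[v]; rewrite -ltnNge addn0 => lt.
  have vt : v <= t.
    have := ltn_ord v; rewrite ltnS leq_eqVlt => /orP[/eqP e|//].
    by move: lt; rewrite e ltnn.
  exact: ltn_trans lt (IH v (ltnW tT) vt).
have [d _ [_ _ -> _]] := worm_stepP (stepC tT).
have := IH t (ltnW tT) (leqnn t); rewrite /next_cell addn1.
by case: (_.2) => [[]|] //= /leqW.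
Qed.

(** The number of possible keys of a virgin time: its surface, the possibly void content of its
    cell, and the surface at the last visit to cell 0. *)
Definition cell_bound := #|surface_type| * #|worm_mem A|.+1 * #|surface_type|.

Lemma cell_le_bound u : u <= T -> cell (C u) < cell_bound.
Proof.
move=> uT; apply: leq_trans (cell_lt_virgin (leqnn T) uT) _.
pose V := [set v : 'I_T.+1 | virgin v].
have -> : \sum_(v < T.+1) virgin v = #|V|.
  by rewrite -sum1_card [RHS]big_mkcond /=; apply: eq_bigr => i _; rewrite inE; case: virgin.
pose f (v : 'I_T.+1) := (surface (C v), wc_mem (C v) (cell (C v)), surface (C (last_zero v))).
suff injf : {in V &, injective f}.
  rewrite -(card_in_imset injf) /cell_bound -card_option -!card_prod; exact: max_card.
move=> v v'; rewrite !inE => Vv Vv' ef; apply: val_inj => /=.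
have vT : v <= T by have := ltn_ord v.
have vT' : v' <= T by have := ltn_ord v'.
case: ef => e1 e2 e3 e4 e5.
have s1 : same_surface (C v) (C v') by apply: surfaceP => //; congr pair.
have s2 : same_surface (C (last_zero v)) (C (last_zero v')).
  apply: surfaceP; try (by congr pair);
  exact: leq_trans (last_zero_le _) _.
have sym c c' : same_surface c c' -> same_surface c' c by case.
case: (ltngtP v v') => // lt.
- by case: (virgin_inj lt vT' Vv Vv').
- by case: (virgin_inj lt vT Vv' Vv) => //; apply: sym.
Qed.

(** By [key_inj] no pair of surface and cell repeats up to time [T]; [cell_le_bound] makes the
    encoding of the cell by [inord] lossless. *)
Lemma first_acceptance_bound : T < #|surface_type| * cell_bound.+1.
Proof.
pose f (v : 'I_T.+1) : surface_type * 'I_cell_bound.+1 := (surface (C v), inord (cell (C v))).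
have injf : injective f.
  move=> v v' [e1 e2 e3]; apply: val_inj => /=.
  have vT : v <= T by have := ltn_ord v.
  have vT' : v' <= T by have := ltn_ord v'.
  have s : same_surface (C v) (C v') by apply: surfaceP => //; congr pair.
  have ec : cell (C v) = cell (C v').
    by have := congr1 val e3; rewrite /= !inordK //; apply: ltnW; apply: cell_le_bound.
  case: (ltngtP v v') => // lt.
  - by case: (key_inj lt vT' s ec).
  - by case: (key_inj lt vT _ (esym ec)); case: s.
by have := leq_card f injf; rewrite card_prod !card_ord.
Qed.
End FirstAcceptance.

Lemma first_acceptance : worm_accepts A w ->
  exists T c, [/\ worm_run A w T = Some c, wc_state c \in worm_acc A,
   T < #|surface_type| * cell_bound.+1 &
   forall t c', t < T -> worm_run A w t = Some c' -> wc_state c' \notin worm_acc A].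
Proof.
move=> acc.
pose P t := if worm_run A w t is Some c then wc_state c \in worm_acc A else false.
have exP : exists t, P t by case: acc => t [c [e ac]]; exists t; rewrite /P e.
case: (ex_minnP exP) => T; rewrite {1}/P; case E: (worm_run A w T) => [c|] // ac mn.
have na t c' : t < T -> worm_run A w t = Some c' -> wc_state c' \notin worm_acc A.
  by move=> tT e; apply/negP => a; have := mn t; rewrite /P e => /(_ a); lia.
exists T, c; split=> //; pose C t := odflt c (worm_run A w t).
have rC t : t <= T -> worm_run A w t = Some (C t).
  by move=> tT; have [c' e] := worm_run_prefix E tT; rewrite /C e.
apply: (@first_acceptance_bound T C rC); first by rewrite /C E.
by move=> t tT; apply: (na t) => //; apply: rC; apply: ltnW.
Qed.
End TapeW15.

(** * Simulating an automaton on W_1.5 by a Turing machine *)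

Section TuringStep.
Variables (k : nat) (Sigma : finType) (T : tm k Sigma) (c : tmconf T).

Definition tm_scan := [ffun i => tc_tapes c i (tc_heads c i)].

Lemma tm_stepE : tm_halted c = false ->
  let r := tm_delta (tc_state c) tm_scan in
  [/\ tc_state (tm_step c) = r.1,
      forall i, tc_heads (tm_step c) i = shift_head (r.2 i).2 (tc_heads c i)
    & forall i, tc_tapes (tm_step c) i =
        upd (tc_tapes c i) (tc_heads c i) (r.2 i).1].
Proof. by rewrite /tm_step /tm_scan => ->; case: tm_delta. Qed.
End TuringStep.

Section WormToTuring.
Variables (h : nat) (Sigma : finType) (A : worm W15 h Sigma) (c : nat).

(** Each head and each clock digit gets its own copy of the input between endmarkers, so that it
    moves independently; the original input stays on tape [ord0]. *)
Definition sim_tape : finType := ('I_h + 'I_c + unit)%type.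
Definition tape_of (i : sim_tape) : 'I_#|sim_tape|.+1 := lift ord0 (enum_rank i).

Definition head_tape (i : 'I_h) := tape_of (inl (inl i)).
Definition clock_tape (j : 'I_c) := tape_of (inl (inr j)).
Definition memory_tape := tape_of (inr tt).

(* Of the additional symbols, [inl false] and [inl true] are the endmarkers    *)
(* and [inr d] is the content d of a memory cell.                              *)
Definition sim_aux : finType := (bool + worm_mem A)%type.
Local Notation sym := (tm_sym Sigma sim_aux).

Definition endmark (right : bool) : sym := Some (inr (inl right)).
Definition code_mem (x : option (worm_mem A)) : sym :=
  omap (fun d => inr (inr d)) x.
Definition decode_mem (s : sym) : option (worm_mem A) :=
  if s is Some (inr (inr d)) then Some d else None.
Definition decode_insym (s : sym) : insym Sigma :=
  match s with
  | Some (inl a) => Letter a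
  | Some (inr (inl false)) => LeftEnd
  | _ => RightEnd
  end.
Definition is_letter (s : sym) : bool := if s is Some (inl _) then true else false.

Lemma code_memK x : decode_mem (code_mem x) = x.
Proof. by case: x. Qed.

Definition clip (s : sym) (d : move) : move :=
  match d with
  | MoveLeft => if s == endmark false then MoveStay else MoveLeft
  | MoveStay => MoveStay
  | MoveRight => if s == endmark true then MoveStay else MoveRight
  end.

(* [inl acc] is halted; [inr (inl false)] copies the input to the head and     *)
(* clock tapes, [inr (inl true)] rewinds; [inr (inr (ret, q, dirs))] simulates *)
(* state q, with clock directions dirs, and is performing a return move if ret *)
(* holds.                                                                      *)
Definition sim_state : finType :=
  (bool + (bool + (bool * worm_state A * {ffun 'I_c -> bool})))%type.

Definition actions (act0 : sym * move) (act : sim_tape -> sym * move) :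
    {ffun 'I_#|sim_tape|.+1 -> sym * move} :=
  [ffun j => if unlift ord0 j is Some j' then act (enum_val j') else act0].

(** A return move walks left to the first blank, at position -1, and then steps right. The clock
    also ticks meanwhile, and its overflow rejects. *)
Definition sim_delta (s : sim_state) (r : {ffun 'I_#|sim_tape|.+1 -> sym}) :
    sim_state * {ffun 'I_#|sim_tape|.+1 -> sym * move} :=
  let keep i := (r (tape_of i), MoveStay) in
  let keep0 := (r ord0, MoveStay) in
  match s with
  | inl _ => (s, actions keep0 keep)
  | inr (inl false) =>
    if is_letter (r ord0) then
      (s, actions (r ord0, MoveRight)
            (fun i => if i is inl _ then (r ord0, MoveRight) else keep i))
    else
      (inr (inl true), actions (r ord0, MoveLeft)
            (fun i => if i is inl _ then (endmark true, MoveLeft) else keep i))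
  | inr (inl true) =>
    if is_letter (r ord0) then
      (s, actions (r ord0, MoveLeft)
            (fun i => if i is inl _ then (r (tape_of i), MoveLeft) else keep i))
    else
      (inr (inr (false, worm_start A, [ffun=> true])), actions keep0
            (fun i => match i with
                      | inl (inl _) => (endmark false, MoveRight)
                      | inl (inr _) => (endmark false, MoveStay)
                      | inr _ => keep i
                      end))
  | inr (inr (ret, q, dirs)) =>
    let atl j := r (clock_tape j) == endmark false in
    let atr j := r (clock_tape j) == endmark true in
    let dirs' := [ffun j => count_dir MoveRight dirs atl atr j] in
    let tick j := clip (r (clock_tape j)) (count_move MoveRight dirs atl atr j) in
    if ~~ ret && (q \in worm_acc A) then (inl true, actions keep0 keep)
    else if [forall j, exhausted true dirs atl atr j] then
      (inl false, actions keep0 keep)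
    else if ret then
      let void := decode_mem (r memory_tape) == None in
      (inr (inr (~~ void, q, dirs')), actions keep0
         (fun i => match i with
                   | inl (inl _) => keep i
                   | inl (inr j) => (r (tape_of i), tick j)
                   | inr _ => (r (tape_of i), if void then MoveRight else MoveLeft)
                   end))
    else if fill_cell (worm_fill q) (decode_mem (r memory_tape)) is Some d then
      let: (q', hm, g) :=
        worm_delta q [ffun i => decode_insym (r (head_tape i))] d in
      (inr (inr (g == Some false, q', dirs')), actions keep0
         (fun i => match i with
                   | inl (inl i') => (r (tape_of i), clip (r (tape_of i)) (hm i'))
                   | inl (inr j) => (r (tape_of i), tick j)
                   | inr _ => (code_mem (Some d),
                               match g with
                               | None => MoveStay
                               | Some true => MoveRight
                               | Some false => MoveLeft
                               end)
                   end))
    else (inl false, actions keep0 keep)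
  end.

Definition sim_tm : tm #|sim_tape| Sigma :=
  @TM #|sim_tape| Sigma sim_state sim_aux sim_delta (inr (inl false))
    (inl true) (inl false) isT.

Lemma actions0 act0 act : actions act0 act ord0 = act0.
Proof. by rewrite ffunE unlift_none. Qed.

Lemma actions_tape act0 act i : actions act0 act (tape_of i) = act i.
Proof. by rewrite ffunE liftK enum_rankK. Qed.

Variable w : seq Sigma.
Local Notation n := (size w).
Local Notation input := (@input_tape Sigma w sim_aux).
Implicit Types x : tmconf sim_tm.

Lemma input_letter (z : int) : is_letter (input z) = (0 <= z < Posz n)%R.
Proof.
case: z => m //=; case: (ltnP m n) => lt.
  by have [a0 _] : exists a : Sigma, true; [case: w lt => // a; exists a |
     rewrite (nth_map a0) //=; lia].
by rewrite nth_default ?size_map //=; lia.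
Qed.

Lemma input_non_letter (z : int) : ~~ is_letter (input z) -> input z = None.
Proof.
case: z => m //=; case: (ltnP m n) => lt; last by rewrite nth_default ?size_map.
have [a0 _] : exists a : Sigma, true by case: w lt => // a; exists a.
by rewrite (nth_map a0).
Qed.

(** The endmarkers surround an input that starts at tape cell 0, so head position p of the automaton
    is tape cell p - 1. *)
Definition marked (z : int) : sym :=
  if z == (-1)%R then endmark false
  else if z == Posz n then endmark true else input z.

Lemma marked_insym (p : nat) : p <= n.+1 ->
  decode_insym (marked (Posz p - 1)) = insym_at w p.
Proof.
case: p => [|p] //; rewrite ltnS => pn.
rewrite /marked (_ : (Posz p.+1 - 1 = Posz p)%R); last by lia.
rewrite /insym_at /= eqz_nat; case: eqP => [->|/eqP np].
  by rewrite nth_rcons size_map ltnn eqxx.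
have lt : p < n by rewrite ltn_neqAle np.
have [a0 _] : exists a : Sigma, true by case: w lt => // a; exists a.
by rewrite /= nth_rcons size_map lt !(nth_map a0).
Qed.

Lemma marked_left (p : nat) : (marked (Posz p - 1) == endmark false) = (p == 0).
Proof.
case: p => [|p] //; rewrite /marked (_ : (Posz p.+1 - 1 = Posz p)%R); last by lia.
case: (Posz p =P Posz n) => // _; apply/negbTE/negP => /eqP e.
by have := @input_non_letter p; rewrite e => /(_ isT).
Qed.

Lemma marked_right (p : nat) : (marked (Posz p - 1) == endmark true) = (p == n.+1).
Proof.
case: p => [|p] //; rewrite /marked (_ : (Posz p.+1 - 1 = Posz p)%R); last by lia.
rewrite /= eqSS eqz_nat; case: (p =P n) => [//|np]; apply/negbTE/negP => /eqP e.
by have := @input_non_letter p; rewrite /= e => /(_ isT).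
Qed.

Lemma shift_clip d (p : nat) : p <= n.+1 ->
  shift_head (clip (marked (Posz p - 1)) d) (Posz p - 1) =
  (Posz (move_head w d p) - 1)%R.
Proof.
case: d => pn //=; rewrite ?marked_left ?marked_right; case: eqP => e /=; lia.
Qed.

(** * Invariants of the simulating Turing machine *)

Definition copying (t : nat) x :=
  [/\ tc_state x = inr (inl false),
      tc_heads x ord0 = Posz t /\ (forall z, tc_tapes x ord0 z = input z),
      forall i, tc_heads x (tape_of (inl i)) = Posz t,
      forall i z, tc_tapes x (tape_of (inl i)) z = if (z < Posz t)%R then input z else None
    & tc_heads x memory_tape = 0%R /\ forall z, tc_tapes x memory_tape z = None].

(** Here [t] runs down; at 0 the heads are at -1, where the left endmarker is to be written. *)
Definition rewinding (t : nat) x :=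
  [/\ tc_state x = inr (inl true),
      tc_heads x ord0 = (Posz t - 1)%R /\ (forall z, tc_tapes x ord0 z = input z),
      forall i, tc_heads x (tape_of (inl i)) = (Posz t - 1)%R,
      forall i z, tc_tapes x (tape_of (inl i)) z =
        if z == Posz n then endmark true else input z
    & tc_heads x memory_tape = 0%R /\ forall z, tc_tapes x memory_tape z = None].

Lemma copying_init : copying 0 (tm_init sim_tm w).
Proof.
by split=> // i z; case: z.
Qed.

Lemma copying_step t x : copying t x -> t < n -> copying t.+1 (tm_step x).
Proof.
move=> [es [eh0 et0] eh et [ehm etm]] tn.
have [|Es Eh Et] := @tm_stepE _ _ sim_tm x; first by rewrite /tm_halted es.
move: Es Eh Et; rewrite es /= !ffunE eh0 et0 (_ : is_letter _); last first.
  by rewrite input_letter; lia.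
move=> /= Es Eh Et; split=> //.
- rewrite Eh actions0 eh0; split=> [|z]; first by rewrite /=; lia.
  by rewrite Et actions0 /upd /= eh0; case: eqP => // ->.
- by move=> i; rewrite Eh actions_tape eh /=; lia.
- move=> i z; rewrite Et actions_tape /= eh /upd et.
  case: eqP => [->|ne]; first by rewrite ltz_nat ltnSn.
  by rewrite (_ : (z < Posz t.+1) = (z < Posz t))%R //; apply/idP/idP; lia.
- rewrite Eh actions_tape ehm; split=> // z.
  by rewrite Et actions_tape /upd /= ffunE ehm !etm if_same.
Qed.

Lemma copying_end x : copying n x -> rewinding n (tm_step x).
Proof.
move=> [es [eh0 et0] eh et [ehm etm]].
have [|Es Eh Et] := @tm_stepE _ _ sim_tm x; first by rewrite /tm_halted es.
move: Es Eh Et; rewrite es /= !ffunE eh0 et0 ifN; last first.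
  by rewrite input_letter; lia.
move=> /= Es Eh Et; split=> //.
- rewrite Eh actions0 eh0; split=> // z.
  by rewrite Et actions0 /upd /= eh0; case: eqP => // ->.
- by move=> i; rewrite Eh actions_tape eh.
- move=> i z; rewrite Et actions_tape /= eh /upd et.
  case: eqP => // ne; case: ifP => // lt.
  by rewrite input_non_letter // input_letter; lia.
- rewrite Eh actions_tape ehm; split=> // z.
  by rewrite Et actions_tape /upd /= ffunE ehm !etm if_same.
Qed.

Lemma rewinding_step t x : rewinding t.+1 x -> t < n -> rewinding t (tm_step x).
Proof.
move=> [es [eh0 et0] eh et [ehm etm]] tn.
have [|Es Eh Et] := @tm_stepE _ _ sim_tm x; first by rewrite /tm_halted es.
move: Es Eh Et; rewrite es /= !ffunE eh0 et0 (_ : is_letter _); last first.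
  by rewrite input_letter; lia.
move=> /= Es Eh Et; split=> //.
- rewrite Eh actions0 eh0; split=> [|z]; first by rewrite /=; lia.
  by rewrite Et actions0 /upd /= eh0; case: eqP => // ->.
- by move=> i; rewrite Eh actions_tape eh /=; lia.
- move=> i z; rewrite Et actions_tape /= ffunE eh /upd !et.
  by case: (z =P (Posz t.+1 - 1)%R) => [->|].
- rewrite Eh actions_tape ehm; split=> // z.
  by rewrite Et actions_tape /upd /= ffunE ehm !etm if_same.
Qed.

(** [v] is the clock value and [t] the number of automaton steps simulated. Since all cells below
    the current one are filled, a return move started there meets its first blank left of cell 0. *)
Definition sim_common (v t : nat) (k : wconf A) (ret : bool) x :=
  [/\ worm_run A w t = Some k,
      forall t' k', t' < t -> worm_run A w t' = Some k' -> wc_state k' \notin worm_acc A,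
      forall i, tc_heads x (head_tape i) = (Posz (wc_heads k i) - 1)%R,
      forall i z, tc_tapes x (tape_of (inl i)) z = marked z
    & exists (d : {ffun 'I_c -> bool}) (p : 'I_c -> nat),
      [/\ tc_state x = inr (inr (ret, wc_state k, d)),
        forall j, tc_heads x (clock_tape j) = (Posz (p j) - 1)%R,
        represents n (Posz v) d p & v < n.+2 ^ c] ] /\
  [/\ forall m : nat, tc_tapes x memory_tape (Posz m) = code_mem (wc_mem k m),
      forall m, tc_tapes x memory_tape (Negz m) = None,
      forall m, m < cell k -> wc_mem k m != None
    & cell k <= t].

(** A return move from cell m takes m + 2 ticks, and m <= t, while the budget t (t + 3) grows by 2 t
    + 4 per automaton step. With [y] filled cells left to cross, v + y + 1 is the clock value when
    the return ends. *)
Definition simulating v x := exists t k,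
  (sim_common v t k false x /\
   tc_heads x memory_tape = Posz (cell k) /\ v <= t * (t + 3))
  \/
  (sim_common v t k true x /\ cell k = 0 /\
   exists y : nat, [/\ tc_heads x memory_tape = (Posz y - 1)%R,
     forall m, m < y -> wc_mem k m != None & v + y + 1 <= t * (t + 3)]).

Lemma rewinding_end x : rewinding 0 x -> simulating 0 (tm_step x).
Proof.
move=> [es [eh0 et0] eh et [ehm etm]].
have [|Es Eh Et] := @tm_stepE _ _ sim_tm x; first by rewrite /tm_halted es.
move: Es Eh Et; rewrite es /= !ffunE eh0 et0 /= => Es Eh Et.
have mh : tc_heads (tm_step x) memory_tape = 0%R by rewrite Eh actions_tape ehm.
have mt z : tc_tapes (tm_step x) memory_tape z = None.
  by rewrite Et actions_tape /upd /= ffunE ehm !etm if_same.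
exists 0, (worm_init A); left; split=> //; split; split=> //.
- by move=> i; rewrite Eh actions_tape eh /= ffunE.
- move=> i z; rewrite Et actions_tape eh /upd et /marked; case: i => i /=.
    by case: eqP.
  by case: eqP.
- exists [ffun=> true], (fun=> 0); split=> //.
  + by move=> j; rewrite Eh actions_tape eh.
  + by move=> j; have [e1 e2] := @represents_small n c 0 isT j;
      rewrite ffunE -e1 -e2 if_same.
  by rewrite expn_gt0.
Qed.

Definition time_bound := #|surface_type A w| * (cell_bound A w).+1.

Hypothesis clock_size : time_bound * (time_bound + 3) + 2 <= n.+2 ^ c.

(** By [clock_size], a full clock means that [t] exceeds [time_bound], whereas a first acceptance
    would come before [time_bound] and not before [t]. *)
Lemma clock_full_rejects v t k : worm_run A w t = Some k ->
  (forall t' k', t' < t -> worm_run A w t' = Some k' -> wc_state k' \notin worm_acc A) ->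
  v <= t * (t + 3) -> v.+1 = n.+2 ^ c -> ~ worm_accepts A w.
Proof.
move=> rt na vt vc /first_acceptance [T [k' [rT aT TB _]]].
have tT : t <= T by case: leqP => // lt; move: aT; rewrite (negbTE (na _ _ lt rT)).
move: clock_size TB; rewrite -vc -/time_bound; move: time_bound => B; nia.
Qed.

Lemma error_rejects t k : worm_run A w t = Some k ->
  (forall t' k', t' < t -> worm_run A w t' = Some k' -> wc_state k' \notin worm_acc A) ->
  wc_state k \notin worm_acc A -> worm_step w k = None -> ~ worm_accepts A w.
Proof.
move=> rt na nk st [T [k' [rT aT]]].
case: (ltngtP T t) => [lt|lt|e].
- by move: aT; rewrite (negbTE (na _ _ lt rT)).
- by have [k0] := worm_run_prefix rT lt; rewrite worm_runS rt /= st.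
- by move: rT aT nk; rewrite e rt => -[<-] ->.
Qed.

Lemma clock_tick v x (d : {ffun 'I_c -> bool}) p
    (r : 'I_c -> sym) (atl := fun j => r j == endmark false)
    (atr := fun j => r j == endmark true) :
  (forall j, r j = marked (Posz (p j) - 1)) ->
  (forall j, tc_heads x (clock_tape j) = (Posz (p j) - 1)%R) ->
  represents n (Posz v) d p -> v < n.+2 ^ c ->
  [forall j, exhausted true d atl atr j] = (v.+1 == n.+2 ^ c) /\
  (v.+1 != n.+2 ^ c -> exists p',
    [/\ represents n (Posz v.+1) [ffun j => count_dir MoveRight d atl atr j] p',
        v.+1 < n.+2 ^ c &
        forall j, shift_head (clip (r j) (count_move MoveRight d atl atr j))
          (tc_heads x (clock_tape j)) = (Posz (p' j) - 1)%R]).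
Proof.
move=> er eh R vc.
have el : atl =1 at_left p by move=> j; rewrite /atl er marked_left.
have er' : atr =1 at_right n p by move=> j; rewrite /atr er marked_right.
have v1 : (Posz v + 1 = Posz v.+1)%R by lia.
split.
  under eq_forallb => j do rewrite (eq_exhausted _ _ el er').
  rewrite (all_exhaustedE R) ?ltz_nat //; last by lia.
move=> nv.
exists (fun j => cmove n (count_move MoveRight d (at_left p) (at_right n p) j) (p j)).
split.
- move=> j; have := represents_count MoveRight R j; rewrite [shift_head _ _]v1.
  by rewrite ffunE (eq_count_dir _ _ el er').
- by rewrite ltn_neqAle nv.
move=> j; rewrite eh er (eq_count_move _ _ el er') shift_clip //.
by have [_ ->] := R j; have := cpos_bound n j (Posz v).
Qed.

Lemma simulating_step v x : simulating v x ->
  (tm_halted (tm_step x) /\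
     (worm_accepts A w <-> tc_state (tm_step x) = inl true)) \/
  simulating v.+1 (tm_step x).
Proof.
move=> [t [k H]].
have : exists ret, sim_common v t k ret x /\ v <= t * (t + 3).
  by case: H => [[S [_ vt]]|[S [_ [y [_ _ vt]]]]]; [exists false|exists true; split=> //; lia].
move=> [ret [[[rt na hh ht [d [p [es eh R vc]]]] [mt mn mf ct]] vt]].
have [|Es Eh Et] := @tm_stepE _ _ sim_tm x; first by rewrite /tm_halted es.
move: Es Eh Et; set r := tm_scan x; rewrite es /=.
have rc j : r (clock_tape j) = marked (Posz (p j) - 1) by rewrite ffunE eh ht.
have rh i : r (head_tape i) = marked (Posz (wc_heads k i) - 1).
  by rewrite ffunE hh ht.
have [full tick] := clock_tick rc eh R vc.
case: ifP => [/andP[nret ak]|nacc] Es Eh Et.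
  left; rewrite /tm_halted Es; split=> //; split=> // _; exists t, k; split=> //.
move: Es Eh Et; rewrite full; case: eqP => [fv|/eqP nv] Es Eh Et.
  left; rewrite /tm_halted Es; split=> //; split=> // ac.
  by case: (clock_full_rejects rt na vt fv).
have {tick full} [p' [R' vc' eh']] := tick nv.
have rt_tape i : r (tape_of i) = tc_tapes x (tape_of i) (tc_heads x (tape_of i)).
  by rewrite ffunE.
case: H => [[S [hm _]]|[S [ck0 [y [hm yf vy]]]]].
  have {S} e : ret = false.
    by case: S => -[_ _ _ _ [d' [p'' [es' _ _ _]]]] _; move: es'; rewrite es => -[].
  subst ret.
  have rm : decode_mem (r memory_tape) = wc_mem k (cell k).
    by rewrite ffunE hm mt code_memK.
  move: Es Eh Et; rewrite rm.
  case Ef: fill_cell => [dd|] Es Eh Et; last first.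
    left; rewrite /tm_halted Es; split=> //; split=> // ac.
    case: (error_rejects rt na _ _ ac); first exact: (negbT nacc).
    by rewrite /worm_step -/(cell k) Ef.
  have hd : [ffun i => decode_insym (r (head_tape i))] =
            [ffun i => insym_at w (wc_heads k i)].
    by apply/ffunP => i; rewrite [LHS]ffunE [RHS]ffunE rh marked_insym ?(worm_run_heads rt).
  case Est: (worm_step w k) => [k'|]; last first.
    by move: Est; rewrite /worm_step -/(cell k) Ef; case: worm_delta => [[]].
  have [d2] := worm_stepP Est; rewrite Ef => -[?]; subst d2.
  move: Es Eh Et; rewrite /worm_action hd; case: worm_delta => [[q' hmv] g] /=.
  move=> Es Eh Et [es1 eh1 ec1 em1].
  have Com : sim_common v.+1 t.+1 k' (g == Some false) (tm_step x).
    split; split=> //.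
    - by rewrite worm_runS rt /= Est.
    - move=> t' k0; rewrite ltnS leq_eqVlt => /orP[/eqP->|]; last exact: na.
      by rewrite rt => -[<-]; exact: (negbT nacc).
    - move=> i; rewrite Eh actions_tape hh -/(head_tape i) rh eh1 ffunE.
      by rewrite shift_clip // (worm_run_heads rt).
    - move=> i z; rewrite Et actions_tape /upd; case: eqP => [->|_]; last exact: ht.
      by case: i => i /=; rewrite ffunE ht.
    - exists [ffun j => count_dir MoveRight d (fun j => r (clock_tape j) == endmark false)
                (fun j => r (clock_tape j) == endmark true) j], p'; split=> //.
      + by rewrite Es es1.
      + by move=> j; rewrite Eh actions_tape -eh'.
    - by move=> m; rewrite Et actions_tape em1 /upd hm eqz_nat mt; case: eqP.
    - by move=> m; rewrite Et actions_tape /upd hm mn.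
    - move=> m; rewrite em1 /upd ec1 => mlt; case: (m =P _) => // /eqP ne.
      apply: mf; move: mlt; rewrite /next_cell; case: (g) => [[]|] //.
      by rewrite ltnS leq_eqVlt (negbTE ne).
    by rewrite ec1 /next_cell; case: (g) => [[]|] //; exact: leqW.
  right; exists t.+1, k'.
  have hm' : tc_heads (tm_step x) memory_tape =
      shift_head match g with None => MoveStay | Some true => MoveRight
                 | Some false => MoveLeft end (Posz (cell k)).
    by rewrite Eh actions_tape hm.
  case: g Com hm' ec1 {Es Eh Et} => [[]|] Com hm' ec1.
  - by left; split=> //; rewrite hm' ec1 /=; split; [lia | nia].
  (* The memory head has just left the old cell leftwards, with [cell k] filled cells still to
     cross. *)
  - right; split=> //; split=> //; exists (cell k); split=> //; last by nia.
    move=> m mk; rewrite em1 /upd; case: (m =P _) => // _; exact: mf.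
  - by left; split=> //; rewrite hm' ec1 /=; split; [lia | nia].
have {S} e : ret = true.
    by case: S => -[_ _ _ _ [d' [p'' [es' _ _ _]]]] _; move: es'; rewrite es => -[].
subst ret.
have rm : decode_mem (r memory_tape) = if y is y'.+1 then wc_mem k y' else None.
  rewrite ffunE hm; case: y {hm yf vy} => [|y]; first by rewrite mn.
  by rewrite (_ : (Posz y.+1 - 1 = Posz y)%R) ?mt ?code_memK //; lia.
right; exists t, k.
have mt' z : tc_tapes (tm_step x) memory_tape z = tc_tapes x memory_tape z.
  by rewrite Et /= actions_tape /upd /= ffunE; case: eqP => // ->.
have Com ret : tc_state (tm_step x) = inr (inr (ret, wc_state k,
   [ffun j => count_dir MoveRight d (fun j => r (clock_tape j) == endmark false)
                (fun j => r (clock_tape j) == endmark true) j])) ->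
   sim_common v.+1 t k ret (tm_step x).
  move=> Es'; split; split=> //; try by move=> *; rewrite mt'.
  - by move=> i; rewrite Eh /= actions_tape hh.
  - move=> i z; rewrite Et /= actions_tape /upd; case: eqP => [->|_]; last exact: ht.
    by case: i => i /=; rewrite ffunE ht.
  - exists [ffun j => count_dir MoveRight d (fun j => r (clock_tape j) == endmark false)
                (fun j => r (clock_tape j) == endmark true) j], p'; split=> // j.
    by rewrite Eh /= actions_tape -eh'.
(* For y = 0 the head reads the blank at -1 and the return ends. *)
move: Es; rewrite /= rm; case: y hm yf vy rm => [|y] hm yf vy rm Es.
  left; split; first exact: Com.
  rewrite Eh /= actions_tape rm hm ck0; split=> //; lia.
right; split; first by apply: Com; rewrite Es (yf y).
split=> //; exists y; split; last by lia.
  by rewrite Eh /= actions_tape rm (negbTE (yf y _)) // hm /=; lia.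
by move=> m my; apply: yf; lia.
Qed.

(** Copying and rewinding take n + 1 steps each, including the turn. Afterwards every step ticks the
    clock or halts, and the invariant [v < n.+2 ^ c] fails after [n.+2 ^ c] ticks. *)
Lemma sim_tm_correct (x := tm_run sim_tm w (n.+1 + n.+1 + n.+2 ^ c)) :
  tm_halted x /\ (worm_accepts A w <-> tc_state x = tm_acc sim_tm).
Proof.
have cp t : t <= n -> copying t (tm_run sim_tm w t).
  elim: t => [_|t IH tn]; first exact: copying_init.
  exact: copying_step (IH (ltnW tn)) tn.
have rw s : s <= n -> rewinding (n - s) (tm_run sim_tm w (n.+1 + s)).
  elim: s => [_|s IH sn].
    by rewrite subn0 addn0; exact: copying_end (cp n (leqnn n)).
  rewrite addnS; apply: rewinding_step; last by lia.
  by have -> : (n - s.+1).+1 = n - s by [lia]; apply: IH; exact: ltnW.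
have sm v : let y := tm_run sim_tm w (n.+1 + n.+1 + v) in
    (tm_halted y /\ (worm_accepts A w <-> tc_state y = inl true)) \/ simulating v y.
  elim: v => [|v /= IH].
    right; rewrite addn0 addnS; apply: rewinding_end.
    by have := rw n (leqnn n); rewrite subnn.
  rewrite /= addnS /tm_run iterS -/(tm_run _ _ _); case: IH => [[hl ac]|/simulating_step//].
  by left; rewrite /tm_step hl.
have [//|[t [k [[S _]|[S _]]]]] := sm (n.+2 ^ c);
  by case: S => -[_ _ _ _ [d [p [_ _ _]]]]; rewrite ltnn.
Qed.
End WormToTuring.

Lemma R_det_in_P (Sigma : finType) (L : language Sigma) : R_det W15 L -> class_P L.
Proof.
move=> [h [A LA]].
(* [S] counts the surfaces and [B] is [time_bound], both as functions of the input length alone. *)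
pose S n := #|worm_state A| * n.+2 ^ h.
pose B n := S n * (S n * #|worm_mem A|.+1 * S n).+1.
have pS : poly_bounded S.
  apply: poly_bounded_mul (poly_bounded_const _) _.
  exact: poly_bounded_exp poly_bounded_id.
have pB : poly_bounded B.
  apply: poly_bounded_mul => //.
  apply: (@poly_bounded_add (fun=> 1) _ (poly_bounded_const 1)).
  by do 2?[apply: poly_bounded_mul => //]; exact: poly_bounded_const.
have [c cP] : poly_bounded (fun n => B n * (B n + 3) + 2).
  apply: poly_bounded_add (poly_bounded_const 2).
  by apply: poly_bounded_mul => //; apply: poly_bounded_add (poly_bounded_const 3).
have eB w : time_bound A w = B (size w).
  by rewrite /time_bound /cell_bound !card_prod !card_ffun !card_ord.
pose p : {poly nat} := (('X + 1%:P) + ('X + 1%:P) + ('X + 2%:P) ^+ c)%R.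
exists _, (sim_tm A c), p => w.
have -> : p.[size w]%R =
          (size w).+1 + (size w).+1 + (size w).+2 ^ c.
  have natX m k : (m ^+ k)%R = m ^ k by elim: k => // k IH; rewrite exprS expnS IH.
  rewrite !hornerD !hornerX horner_exp hornerD hornerX !hornerC natX.
  change (size w + 1 + (size w + 1) + (size w + 2) ^ c =
          (size w).+1 + (size w).+1 + (size w).+2 ^ c).
  by rewrite addn1 addn2.
have [|hl ac] := @sim_tm_correct _ _ A c w; first by rewrite eB.
by split=> //; rewrite LA.
Qed.

(** * Simulating a Turing machine on W_1.5 *)

Section TuringToWorm.
Variables (k : nat) (Sigma : finType) (T : tm k Sigma) (c : nat).
Local Notation K := (k.+1).
Local Notation sym := (tm_sym Sigma (tm_aux T)).

(* [Some (Some i, b)] are the two counters of tape i, [Some (None, b)] those   *)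
(* of the time and [None] is the counter that locates the input letter under   *)
(* the head of the first tape.                                                 *)
Definition ctr : finType := option (option 'I_K * bool).
Definition digit : finType := (ctr * 'I_c.+1)%type.
Definition head_of (e : ctr) (j : 'I_c.+1) : 'I_#|digit| := enum_rank ((e, j) : digit).

Definition record_type : finType := (tm_state T * {ffun 'I_K -> sym})%type.

(* None initializes the counters, [inl (q, last)] scans the history and        *)
(* [inr d] writes the record d. The boolean of the state tells which of the    *)
(* two counters of each pair runs down during the current scan.                *)
Definition mode : finType :=
  option ((tm_state T * {ffun 'I_K -> option sym}) + record_type).
Definition history_state : finType := (mode * bool * {ffun digit -> bool})%type.

Section Transition.
Variables (r : {ffun 'I_#|digit| -> insym Sigma}) (d : {ffun digit -> bool}).

Definition reads_left e j := if r (head_of e j) is LeftEnd then true else false.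
Definition reads_right e j := if r (head_of e j) is RightEnd then true else false.
Definition dir_of e j := d (e, j).

Definition ctr_zero e :=
  [forall j, is_zero (dir_of e) (reads_left e) (reads_right e) j].

Definition ctr_dirs (op : ctr -> move) : {ffun digit -> bool} :=
  [ffun ej : digit => count_dir (op ej.1) (dir_of ej.1)
     (reads_left ej.1) (reads_right ej.1) ej.2].

Definition ctr_moves (op : ctr -> move) : {ffun 'I_#|digit| -> move} :=
  [ffun i => let ej : digit := enum_val i in count_move (op ej.1) (dir_of ej.1)
     (reads_left ej.1) (reads_right ej.1) ej.2].

(** Counter [None] holds the position on the first tape plus one. If its higher digits are zero, the
    head of digit 0 stands on the wanted input letter; otherwise the cell lies outside the input and
    is initially blank. *)
Definition scanned_input : sym :=
  if [forall j : 'I_c.+1,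
       (0 < j) ==> is_zero (dir_of None) (reads_left None) (reads_right None) j]
  then if r (head_of None ord0) is Letter a then Some (inl a) else None
  else None.
End Transition.

Definition initial_sym (s : sym) (i : 'I_K) : sym := if i == ord0 then s else None.

Definition opposite (m : move) : move :=
  match m with
  | MoveLeft => MoveRight
  | MoveStay => MoveStay
  | MoveRight => MoveLeft
  end.

Definition written (x : option record_type) (i : 'I_K) : option sym :=
  omap (fun y : record_type => ((tm_delta y.1 y.2).2 i).1) x.
Definition moved (x : option record_type) (i : 'I_K) : move :=
  if x is Some y then ((tm_delta y.1 y.2).2 i).2 else MoveStay.

(** The record read in cell s describes the step from time s - 1 to s. One position counter of each
    pair follows pos t - pos s, its partner pos s; the time counters stop in the last cell, where t
    - s = 0. *)
Definition scan_op (x : option record_type) (sw last : bool) (e : ctr) : move :=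
  match e with
  | None => MoveStay
  | Some (None, b) =>
    if last then MoveStay else if b == sw then MoveLeft else MoveRight
  | Some (Some i, b) => if b == sw then opposite (moved x i) else moved x i
  end.

(** The zero test precedes the counter update, so it concerns the position at time s - 1, where the
    recorded symbol was written. *)
Definition scan_last r d (x : option record_type) sw
    (last : {ffun 'I_K -> option sym}) : {ffun 'I_K -> option sym} :=
  [ffun i => if ctr_zero r d (Some (Some i, sw)) then
               if written x i is Some y then Some y else last i
             else last i].

Definition write_op (y : record_type) (sw : bool) (e : ctr) : move :=
  match e with
  | None => ((tm_delta y.1 y.2).2 ord0).2
  | Some (None, b) => if b == sw then MoveStay else MoveRight
  | Some (Some i, b) => if b == sw then MoveStay else ((tm_delta y.1 y.2).2 i).2
  end.

Definition halting (q : tm_state T) := (q == tm_acc T) || (q == tm_rej T).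

(** All heads start at position 1, so the initial step moves them to 0, except digit 0 of counter
    [None], whose initial value is 1. A halting state of the Turing machine loops forever. *)
Definition history_delta (s : history_state) (r : {ffun 'I_#|digit| -> insym Sigma})
    (x : option record_type) :
    history_state * {ffun 'I_#|digit| -> move} * option bool :=
  let: (m, sw, d) := s in
  match m with
  | None =>
    ((Some (inl (tm_start T, [ffun=> None])), false, [ffun=> true]),
     [ffun i => if enum_val i == (None, ord0) :> digit then MoveStay else MoveLeft],
     None)
  | Some (inl (q, last)) =>
    if halting q then (s, [ffun=> MoveStay], None) else
    let last' := scan_last r d x sw last in
    let fin := ctr_zero r d (Some (None, sw)) in
    let op := scan_op x sw fin in
    let m' := if fin then
        inr (q, [ffun i => odflt (initial_sym (scanned_input r d) i) (last' i)])
      else inl (q, last') in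
    ((Some m', sw, ctr_dirs r d op), ctr_moves r d op, Some true)
  | Some (inr y) =>
    let op := write_op y sw in
    ((Some (inl ((tm_delta y.1 y.2).1, [ffun=> None])), ~~ sw, ctr_dirs r d op),
     ctr_moves r d op, Some false)
  end.

(** The inner [None] is a genuine symbol, written in cell 0 before all records; it differs from
    void. *)
Definition history_fill (s : history_state) : option (option record_type) :=
  match s.1.1 with
  | None => Some None
  | Some (inl _) => None
  | Some (inr y) => Some (Some y)
  end.

Definition history_worm : worm W15 #|digit| Sigma :=
  @Worm W15 #|digit| Sigma history_state (option record_type : finType)
    history_delta (None, false, [ffun=> true])
    [set s : history_state |
       if s.1.1 is Some (inl (q, _)) then q == tm_acc T else false]
    history_fill.

Variable w : seq Sigma.
Local Notation n := (size w).
Implicit Types x : wconf history_worm.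

Definition scan_insym x := [ffun i => insym_at w (wc_heads x i)].

Definition counters (z : ctr -> int) (d : {ffun digit -> bool})
    (hs : {ffun 'I_#|digit| -> nat}) :=
  forall e, represents n (z e) (dir_of d e) (fun j => hs (head_of e j)).

Lemma insym_at_left p : (if insym_at w p is LeftEnd then true else false) = (p == 0).
Proof.
case: p => // p; rewrite /insym_at /= nth_rcons size_map.
case: ltnP => [lt|]; last by case: eqP.
have [a0 _] : exists a : Sigma, true by case: w lt => // a; exists a.
by rewrite (nth_map a0).
Qed.

Lemma insym_at_right p : p <= n.+1 ->
  (if insym_at w p is RightEnd then true else false) = (p == n.+1).
Proof.
case: p => // p pn; rewrite /insym_at /= nth_rcons size_map eqSS.
case: ltnP => [lt|le]; last by have -> : p = n by [lia]; rewrite eqxx.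
have [a0 _] : exists a : Sigma, true by case: w lt => // a; exists a.
by rewrite (nth_map a0) //= ltn_eqF.
Qed.

Lemma insym_at_input (z : int) : (0 <= z < Posz n.+2)%R ->
  (if insym_at w `|z|%N is Letter a then Some (inl a) else None) =
  input_tape w (tm_aux T) (z - 1).
Proof.
case: z => // -[|p] // pn; rewrite (_ : (Posz p.+1 - 1 = Posz p)%R); last by lia.
rewrite /insym_at /= nth_rcons size_map.
case: ltnP => [lt|le]; last by rewrite nth_default ?size_map //; case: eqP.
have [a0 _] : exists a : Sigma, true by case: w lt => // a; exists a.
by rewrite !(nth_map a0).
Qed.

Section Counters.
Variables (z : ctr -> int) (d : {ffun digit -> bool}) (x : wconf history_worm).
Hypothesis R : counters z d (wc_heads x).
Local Notation pos := (fun e j => wc_heads x (head_of e j)).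

Lemma counters_bound e j : wc_heads x (head_of e j) <= n.+1.
Proof. by have [_ ->] := R e j; have := cpos_bound n j (z e). Qed.

Lemma reads_leftE e : reads_left (scan_insym x) e =1 at_left (pos e).
Proof. by move=> j; rewrite /reads_left ffunE insym_at_left. Qed.

Lemma reads_rightE e : reads_right (scan_insym x) e =1 at_right n (pos e).
Proof. by move=> j; rewrite /reads_right ffunE insym_at_right // counters_bound. Qed.

Lemma counters_step op :
  counters (fun e => shift_head (op e) (z e)) (ctr_dirs (scan_insym x) d op)
    [ffun i => move_head w (ctr_moves (scan_insym x) d op i) (wc_heads x i)].
Proof.
move=> e j; have := represents_count (op e) (R e) j.
rewrite /dir_of !ffunE enum_rankK /=.
rewrite (eq_count_dir _ _ (reads_leftE e) (reads_rightE e)).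
by rewrite (eq_count_move _ _ (reads_leftE e) (reads_rightE e)).
Qed.

Lemma ctr_zeroE e : `|z e|%N < n.+2 ^ c.+1 ->
  ctr_zero (scan_insym x) d e = (z e == 0%R).
Proof.
move=> zb; rewrite -(all_is_zeroE (R e) zb); apply: eq_forallb => j.
by rewrite /is_zero reads_leftE reads_rightE.
Qed.

Lemma scanned_inputE : `|z None|%N + n.+2 <= n.+2 ^ c.+1 ->
  scanned_input (scan_insym x) d = input_tape w (tm_aux T) (z None - 1).
Proof.
move=> zb; rewrite /scanned_input.
have -> : [forall j : 'I_c.+1, (0 < j) ==>
     is_zero (dir_of d None) (reads_left (scan_insym x) None)
       (reads_right (scan_insym x) None) j] = (0 <= z None < Posz n.+2)%R.
  rewrite -(high_is_zeroE (R None) zb); apply: eq_forallb => j.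
  by rewrite /is_zero reads_leftE reads_rightE.
rewrite ffunE; case: ifP => zn.
  rewrite -insym_at_input // -(represents_digit0 (j := ord0) (R None) zn) //=.
case: (z None) zn => [m zn|//].
have -> : (Posz m - 1 = Posz m.-1)%R by lia.
by rewrite /= nth_default // size_map; lia.
Qed.
End Counters.

Lemma counters_ext z z' d hs : (forall e, z e = z' e) ->
  counters z d hs -> counters z' d hs.
Proof. by move=> ez R e; rewrite -ez. Qed.

(** * Invariants of the history automaton *)

Local Notation run t := (tm_run T w t).
Definition pos i t := tc_heads (run t) i.
Definition tape i t := tc_tapes (run t) i.
Definition record_at t : record_type := (tc_state (run t), tm_scan (run t)).

Lemma pos_bound i t : `|pos i t|%N <= t.
Proof.
elim: t => // t IH; rewrite /pos /tm_run iterS -/(run t) /tm_step.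
case: ifP => _; first exact: leqW.
case: tm_delta => q' acts /=; move: IH; rewrite -/(pos i t).
case: ((acts i).2) => /=; lia.
Qed.

Definition record_before s := if s is s'.+1 then Some (record_at s') else None.

Lemma pos_step s i : (forall u, u < s -> tm_halted (run u) = false) ->
  pos i s = shift_head (moved (record_before s) i) (pos i s.-1).
Proof.
case: s => // s nh; have [_ E _] := tm_stepE (nh s (ltnSn s)).
by rewrite /pos /tm_run iterS -/(run s) E.
Qed.

Lemma tape_step s i z : (forall u, u < s -> tm_halted (run u) = false) ->
  tape i s z = if z == pos i s.-1 then odflt (tape i s.-1 z) (written (record_before s) i)
               else tape i s.-1 z.
Proof.
case: s => [|s] nh; first by rewrite if_same.
have [_ _ E] := tm_stepE (nh s (ltnSn s)).
by rewrite /tape /tm_run iterS -/(run s) E.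
Qed.

(** Cell s is entered but its record is not yet processed, so the positions are those of time s - 1,
    or of time 0 when s = 0. *)
Definition scan_ctr t s sw (e : ctr) : int :=
  match e with
  | None => pos ord0 t + 1
  | Some (None, b) => if b == sw then Posz (t - s) else Posz s
  | Some (Some i, b) => if b == sw then pos i t - pos i s.-1 else pos i s.-1
  end%R.

Definition write_ctr t sw (e : ctr) : int :=
  match e with
  | None => pos ord0 t + 1
  | Some (None, b) => if b == sw then 0 else Posz t
  | Some (Some i, b) => if b == sw then 0 else pos i t
  end%R.

Definition history t x := forall m : nat, wc_mem x m =
  if m <= t then Some (record_before m) else None.

Definition scanning t s x := exists sw d last,
  [/\ wc_state x = (Some (inl (tc_state (run t), last)), sw, d), cell x = s,
      counters (scan_ctr t s sw) d (wc_heads x), history t x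
    & forall i, tape i s.-1 (pos i t) = odflt (tape i 0 (pos i t)) (last i)].

Definition writing t x := exists sw d,
  [/\ wc_state x = (Some (inr (record_at t)), sw, d), cell x = t.+1,
      counters (write_ctr t sw) d (wc_heads x) & history t x].

(** Positions up to time [t] are at most [t] in absolute value, so their differences are at most 2
    t; the rest of the bound gives the margin needed by [scanned_inputE]. *)
Lemma scanning_step t s x : s <= t ->
  (forall u, u <= t -> tm_halted (run u) = false) ->
  t.*2 + n + 4 <= n.+2 ^ c.+1 -> scanning t s x ->
  exists x', worm_step w x = Some x' /\
    if s < t then scanning t s.+1 x' else writing t x'.
Proof.
move=> st nh bd [sw [d [last [es ec R H lst]]]].
have nhs u : u < s -> tm_halted (run u) = false by move=> us; apply: nh; lia.
have [|x' [-> es' eh' ec' em']] := @worm_step_fill _ _ history_worm w x (record_before s).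
  by rewrite es /= ec H st.
exists x'; split=> //.
move: es' eh' ec'; rewrite /worm_action -/(scan_insym x) es /=.
rewrite (_ : halting _ = false); last exact: nh.
rewrite /= (ctr_zeroE R); last by rewrite /= eqxx; lia.
rewrite /= eqxx; set fin := (_ == _); rewrite /= ec => es' eh' ec'.
have finE : fin = ~~ (s < t) by rewrite /fin; lia.
have R' := counters_step R (scan_op (record_before s) sw fin).
have H' : history t x'.
  by move=> m; rewrite em' /upd ec H; case: (m =P s) => [->|//]; rewrite st.
set last' := scan_last _ _ _ _ _ in es'.
(* From time s - 1 to s only the cell under the head changes, and the distance counter tells whether
   it is the cell sought. *)
have lst' i : tape i s (pos i t) = odflt (tape i 0 (pos i t)) (last' i).
  have b1 := pos_bound i t; have b2 := pos_bound i s.-1.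
  rewrite tape_step // ffunE (ctr_zeroE R) /= ?eqxx; last by lia.
  rewrite subr_eq0; case: ifP => _; last exact: lst.
  by case: (written _ i) => //=; exact: lst.
have posS i : pos i s = shift_head (moved (record_before s) i) (pos i s.-1).
  exact: pos_step.
have oppS i : (pos i t - pos i s = shift_head (opposite (moved (record_before s) i))
     (pos i t - pos i s.-1))%R.
  by rewrite posS; case: moved => /=; lia.
rewrite -eh' in R'; case: (ltnP s t) finE => lt finE; rewrite finE /= in es' R' eh'.
  exists sw, (ctr_dirs (scan_insym x) d (scan_op (record_before s) sw false)), last'.
  split=> //; apply: counters_ext R' => -[[[i|] b]|] //=.
  - by case: eqP => _; rewrite -?posS -?oppS.
  - by case: eqP => /=; lia.
have e : s = t by [lia]; clear ec; subst s.
exists sw, (ctr_dirs (scan_insym x) d (scan_op (record_before t) sw true)).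
split=> //.
  rewrite es' /record_at; congr (Some (inr (_, _)), _, _); apply/ffunP => i.
  (* If the scan found no write, the initial content remains: the input on the first tape, blank on
     the others. *)
  rewrite ffunE [RHS]ffunE -/(tape i t) -/(pos i t) lst'; case: (last' i) => //=.
  rewrite (scanned_inputE R) /=; last by have := pos_bound ord0 t; lia.
  by rewrite addrK /initial_sym /tape /=; case: eqP => // ->.
apply: counters_ext R' => -[[[i|] b]|] //=.
- by case: eqP => //= _; rewrite -?oppS ?subrr -?posS.
- by case: eqP => //= _; rewrite subnn.
Qed.

(** Flipping [sw] exchanges the roles: the accumulated position, updated to time t + 1, is the
    distance at the start of the next scan, and the counter that ran down to 0 becomes the
    accumulator. *)
Lemma writing_step t x : tm_halted (run t) = false -> writing t x ->
  exists x', worm_step w x = Some x' /\ scanning t.+1 0 x'.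
Proof.
move=> nh [sw [d [es ec R H]]]; have [E1 E2 _] := tm_stepE nh.
have [|x' [-> es' eh' ec' em']] :=
    @worm_step_fill _ _ history_worm w x (Some (record_at t)).
  by rewrite es /= ec H ltnn.
exists x'; split=> //.
move: es' eh' ec'; rewrite /worm_action -/(scan_insym x) es /= => es' eh' ec'.
exists (~~ sw), (ctr_dirs (scan_insym x) d (write_op (record_at t) sw)), [ffun=> None].
split=> //; last 1 first.
- by move=> i; rewrite ffunE.
- by rewrite es' /tm_run iterS -/(run t) E1.
- have := counters_step R (write_op (record_at t) sw); rewrite -eh'.
  have posS i : pos i t.+1 =
      shift_head ((tm_delta (tc_state (run t)) (tm_scan (run t))).2 i).2 (pos i t).
    by rewrite /pos /tm_run iterS -/(run t) E2.
  apply: counters_ext => -[[[i|] b]|] /=.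
  + by rewrite [pos i 0]/(0%R) subr0 posS; case: (b); case: (sw).
  + by case: (b); case: (sw) => //=; lia.
  + by rewrite posS; case: (_.2) => /=; lia.
move=> m; rewrite em' /upd ec H [RHS]/=; case: (m =P t.+1) => [->|/eqP ne].
  by rewrite leqnn.
by rewrite [m <= t.+1]leq_eqVlt (negbTE ne) ltnS.
Qed.

Lemma scanning_init : exists x, worm_run history_worm w 1 = Some x /\ scanning 0 0 x.
Proof.
have [//|x [E es eh ec em]] :=
  @worm_step_fill _ _ history_worm w (worm_init history_worm) None.
exists x; split=> //; exists false, [ffun=> true], [ffun=> None]; split=> //.
- move=> e j.
  have [zv z2] : exists2 z, z < 2 & scan_ctr 0 0 false e = Posz z /\
      wc_heads x (head_of e j) = if j == 0 :> nat then z else 0.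
    rewrite eh ffunE /worm_action /= !ffunE enum_rankK /=; case: e => [[i b]|].
      by exists 0 => //; rewrite if_same; split=> //; case: i => [i|] /=; case: eqP.
    exists 1 => //; split=> //; rewrite xpair_eqE /=; case: (j =P ord0) => [->|/eqP ne] //.
    by rewrite -[_ == 0]/(j == ord0) (negbTE ne).
  have zb : zv < n.+2 by lia.
  move=> [-> ->]; have [e1 e2] := represents_small zb j.
  by rewrite -e1 -e2 /dir_of ffunE.
- by move=> m; rewrite em /upd; case: m.
by move=> i; rewrite ffunE.
Qed.

Lemma scanning_reach t : (forall u, u < t -> tm_halted (run u) = false) ->
  t.*2 + n + 4 <= n.+2 ^ c.+1 ->
  exists tau x, worm_run history_worm w tau = Some x /\ scanning t 0 x.
Proof.
elim: t => [_ _|t IH nh bd].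
  by have [x Hx] := scanning_init; exists 1, x.
have bd' : t.*2 + n + 4 <= n.+2 ^ c.+1 by lia.
have sc s : s <= t -> exists tau x, worm_run history_worm w tau = Some x /\ scanning t s x.
  elim: s => [_|s IHs st]; first by apply: IH => // u ut; apply: nh; exact: ltnW.
  have [tau [x [e S]]] := IHs (ltnW st).
  have [x' [e']] := scanning_step (ltnW st) nh bd' S.
  by rewrite st => S'; exists tau.+1, x'; rewrite worm_runS e.
have [tau [x [e S]]] := sc t (leqnn t).
have [x' [e']] := scanning_step (leqnn t) nh bd' S.
rewrite ltnn => /(writing_step (nh t (ltnSn t))) [x'' [e'' S'']].
by exists tau.+2, x''; rewrite !worm_runS e /= e'.
Qed.

Lemma halting_step x x' q last sw d : halting q ->
  wc_state x = (Some (inl (q, last)), sw, d) ->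
  worm_step w x = Some x' -> wc_state x' = wc_state x.
Proof.
by move=> hq es /worm_stepP [y _ [-> _ _ _]]; rewrite /worm_action es /= hq.
Qed.

Lemma halting_run tau i x x' q last sw d : halting q ->
  wc_state x = (Some (inl (q, last)), sw, d) ->
  worm_run history_worm w tau = Some x ->
  worm_run history_worm w (tau + i) = Some x' -> wc_state x' = wc_state x.
Proof.
move=> hq es r; elim: i x' => [|i IH] x'; first by rewrite addn0 r => -[<-].
rewrite addnS worm_runS; case E: (worm_run _ _ _) => [x0|] //= st.
have e0 := IH _ E; have es0 := es; rewrite -e0 in es0.
by rewrite (halting_step hq es0 st).
Qed.

Lemma history_worm_correct N : tm_halted (run N) ->
  N.*2 + n + 4 <= n.+2 ^ c.+1 ->
  worm_accepts history_worm w <-> tc_state (run N) = tm_acc T.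
Proof.
move=> hN bd; have exh : exists t, tm_halted (run t) by exists N.
case: (ex_minnP exh) => t ht mint.
have tN : t <= N by apply: mint.
have nh u : u < t -> tm_halted (run u) = false.
  by move=> ut; apply/negP => /mint; lia.
have -> : tc_state (run N) = tc_state (run t).
  rewrite -(subnKC tN); elim: (N - t) => [|i IH]; first by rewrite addn0.
  rewrite addnS /tm_run iterS -/(run (t + i)) /tm_step /tm_halted IH.
  by move: ht; rewrite /tm_halted => ->.
have [|tau [x [r [sw [d [last [es ec _ H _]]]]]]] := scanning_reach nh; first by lia.
split=> [[tau' [x' [r' ax']]]|qa]; last first.
  by exists tau, x; split=> //; rewrite inE es /= qa.
move: ax'; rewrite inE; case Es': (wc_state x') => [[[[[q' l']|y]|] sw'] d'] //= /eqP qa.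
(* Both configurations are in halting modes, so the later one has the same state as the earlier
   one. *)
case: (leqP tau tau') => le.
  have := halting_run ht es r; move: r'; rewrite -(subnKC le) => r' /(_ _ _ r').
  by rewrite Es' es => -[<-].
have := halting_run (q := q') _ Es' r'; move: r; rewrite -(subnKC (ltnW le)) => r.
move/(_ _ _ _ r); rewrite Es' es /halting qa eqxx => /(_ isT) [<-] //.
Qed.
End TuringToWorm.

Lemma P_in_R_det (Sigma : finType) (L : language Sigma) : class_P L -> R_det W15 L.
Proof.
move=> [k [T [p Lp]]].
have [c cP] : poly_bounded (fun n => p.[n]%R + p.[n]%R + n.+2 + 2).
  by do 3?[apply: poly_bounded_add]; try exact: poly_bounded_horner;
    [exact: poly_bounded_id | exact: poly_bounded_const].
exists _, (history_worm T c) => w; have [hl Lw] := Lp w.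
rewrite Lw; apply: iff_sym; apply: history_worm_correct hl _.
apply: leq_trans (_ : (size w).+2 ^ c <= _); last by rewrite leq_pexp2l.
apply: leq_trans (cP _); rewrite -addnn; move: (p.[size w]%R) => m; lia.
Qed.

Theorem theorem1 (Sigma : finType) (L : language Sigma) :
  R_det W15 L <-> class_P L.
Proof. by split; [exact: R_det_in_P | exact: P_in_R_det]. Qed.
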